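(* Let $q\in(0,1)$ and $\nu>-1$. Then the radius of starlikeness $r^*\left(g_{\nu}^{(2)}(\cdot;q)\right)$ of the function $$z\mapsto g_{\nu}^{(2)}(z;q)=2^{\nu}c_{\nu}(q)z^{1-\nu}J_{\nu}^{(2)}(z;q)$$ is the smallest positive root of the equation $r\cdot \frac{d}{dr}J_{\nu}^{(2)}(r;q)-(\nu-1)J_{\nu}^{(2)}(r;q)=0$ and satisfies $$2\sqrt{\frac{(q^{\nu+1}-1)(q-1)}{3q^{\nu+1}}}<r^*\left(g_{\nu}^{(2)}(\cdot;q)\right)< 2\sqrt{\frac{3(q^{\nu+1}-1)(q^{\nu+2}-1)(1-q^2)}{q^{\nu+1}(9q-9q^{\nu+2}+q^{\nu+3}-10q^2+9)}}$$ and $$2\sqrt[4]{\frac{(q^{\nu+1}-1)^2(1-q^{\nu+2})(q-1)^2(q+1)}{q^{2\nu+2}(9q-9q^{\nu+2}+q^{\nu+3}-10q^2+9)}}< r^*\left(g_{\nu}^{(2)}(\cdot;q)\right)<\frac{2}{3}\sqrt{\frac{3(1-q^{\nu+1})(q^{\nu+3}-1)(q-1)}{(q+1)q^{\nu+1}}\,q_1^*(\nu)},$$ where $$q_1^*(\nu)=\frac{(q^3+2q^2+2q+1)(9q-9q^{\nu+2}+q^{\nu+3}-10q^2+9)}{a_{\nu}(q)+b_{\nu}(q)},$$ $$a_{\nu}(q)=-9q^{\nu+2}-12q^{\nu+3}-21q^{\nu+4}+3q^{\nu+5}+6q^{\nu+6}+q^{\nu+7}+9q^{2\nu+5}+3q^{2\nu+6},$$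 $$b_{\nu}(q)=3q^{2\nu+7}+q^{2\nu+8}+18q+3q^2-6q^3-15q^4+7q^6+9.$$
   Context: For $a\in\mathbb{C}$ and $q\in(0,1)$: $(a;q)_0=1$, $(a;q)_n=\prod_{k=1}^{n}(1-aq^{k-1})$, $(a;q)_\infty=\prod_{k\geq1}(1-aq^{k-1})$. The Jackson $q$-Bessel function is, for $\nu>-1$, $$J_{\nu}^{(2)}(z;q)=\frac{(q^{\nu+1};q)_{\infty}}{(q;q)_{\infty}}\sum_{n\geq0}\frac{(-1)^{n}\left(\frac{z}{2}\right)^{2n+\nu}}{(q;q)_{n}(q^{\nu+1};q)_{n}}q^{n(n+\nu)},$$ and $c_{\nu}(q)=(q;q)_{\infty}/(q^{\nu+1};q)_{\infty}$; thus $g_\nu^{(2)}(\cdot;q)$ is entire with $g(0)=0$, $g'(0)=1$. For such $f$, the radius of starlikeness is $r^*(f)=\sup\{r>0:\ \mathrm{Re}\,(zf'(z)/f(z))>0 \text{ for all } |z|<r\}$. *)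

(* Defs.v *)
From Stdlib Require Import Reals.
From Coquelicot Require Import Coquelicot.
Open Scope R_scope.

Fixpoint qpoch (a q : R) (n : nat) : R :=
  match n with
  | O => 1
  | S m => qpoch a q m * (1 - a * q ^ m)
  end.

Definition qpoch_inf (a q : R) : R := real (Lim_seq (fun n => qpoch a q n)).

(* Jackson q-Bessel function J_nu^(2)(r;q), for real r > 0,
   with (r/2)^(2n+nu) the real power *)
Definition J2 (nu q : R) (r : R) : R :=
  qpoch_inf (Rpower q (nu + 1)) q / qpoch_inf q q *
  Series (fun n => (-1) ^ n * Rpower (r / 2) (2 * INR n + nu)
                   * Rpower q (INR n * (INR n + nu))
                   / (qpoch q q n * qpoch (Rpower q (nu + 1)) q n)).

Definition c_nu (nu q : R) : R := qpoch_inf q q / qpoch_inf (Rpower q (nu + 1)) q.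

(* Coefficient of z^(2n+1) in g_nu^(2)(z;q) = 2^nu c_nu(q) z^(1-nu) J_nu^(2)(z;q):
   2^nu c_nu * (q^(nu+1);q)_oo/(q;q)_oo * (-1)^n q^(n(n+nu)) / (2^(2n+nu) (q;q)_n (q^(nu+1);q)_n) *)
Definition g2_coef (nu q : R) (n : nat) : R :=
  (-1) ^ n * Rpower q (INR n * (INR n + nu))
  / (4 ^ n * qpoch q q n * qpoch (Rpower q (nu + 1)) q n).

(* the entire function g_nu^(2)(.;q) on C, as its (everywhere convergent) power series *)
Definition g2 (nu q : R) (z : C) : C :=
  (Series (fun n => g2_coef nu q n * Re (Cpow z (2 * n + 1))),
   Series (fun n => g2_coef nu q n * Im (Cpow z (2 * n + 1)))).

Definition starlike_radii (f : C -> C) : R -> Prop :=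
  fun r => 0 < r /\
    forall z : C, 0 < Cmod z < r ->
      exists l : C, is_derive (K := C_AbsRing) (V := C_NormedModule) f z l /\
                    f z <> 0%C /\ 0 < Re (z * l / f z)%C.

Definition is_radius_starlike (f : C -> C) (rs : R) : Prop :=
  is_lub (starlike_radii f) rs.

Definition a_nu (nu q : R) : R :=
  - 9 * Rpower q (nu + 2) - 12 * Rpower q (nu + 3) - 21 * Rpower q (nu + 4)
  + 3 * Rpower q (nu + 5) + 6 * Rpower q (nu + 6) + Rpower q (nu + 7)
  + 9 * Rpower q (2 * nu + 5) + 3 * Rpower q (2 * nu + 6).

Definition b_nu (nu q : R) : R :=
  3 * Rpower q (2 * nu + 7) + Rpower q (2 * nu + 8) + 18 * q + 3 * q ^ 2
  - 6 * q ^ 3 - 15 * q ^ 4 + 7 * q ^ 6 + 9.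

Definition D_nu (nu q : R) : R :=
  9 * q - 9 * Rpower q (nu + 2) + Rpower q (nu + 3) - 10 * q ^ 2 + 9.

Definition q1_star (nu q : R) : R :=
  (q ^ 3 + 2 * q ^ 2 + 2 * q + 1) * D_nu nu q / (a_nu nu q + b_nu nu q).

(* Main.v *)
Require Import Defs.
From Stdlib Require Import Reals Lra Lia Psatz Epsilon.
From Coquelicot Require Import Coquelicot.
From Stdlib Require Import List.
Open Scope R_scope.

(** Write [g(z) = z F(z^2)] and [g'(z) = G(z^2)], so that [G(x) = F(x) + 2 x F'(x)].
    The partial [q]-binomial truncations of [F] are rescaled [q]-Laguerre polynomials;
    their three-term recurrence makes consecutive quotients map the upper half plane to
    itself, hence they have only real zeros, and Laguerre's argument carries this over to
    the corresponding approximants of [G]. Every approximant is thus a product of factors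
    [1 - p x] with [p > 0], and what is needed about [F] and [G] is proved for such
    products and passed to the limit coefficientwise (Tannery). If [w] is the first
    positive zero of [G], the minimum modulus property of the products gives
    [Re (z g'/g) > 0] for [|z|^2 < w], and the bounds are the Euler-Rayleigh inequalities
    [1 / S_m < w^m] and [w < S_m / S_(m+1)] for the sums [S_m] of the [m]-th powers of the
    reciprocal zeros of [G], which are polynomials in its first Taylor coefficients.
    Signs are dropped throughout: [F] and [G] are represented by their coefficient
    sequences with positive entries, evaluated at [- x]. *)

(** * Polynomials with real zeros *)

(** No Hadamard product of [F] or [G] is formed: the infinite sequence of zeros never occurs, only
    finite products and limits of their coefficients. The obstacle is strictness, since limits turn
    strict inequalities into weak ones. Each finite estimate therefore carries a surplus expressed
    by coefficients or power sums that is still positive after the limit. For the upper bounds it is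
    a lower bound of the gap [S_m - r S_(m+1)], obtained by weighting the terms of the gap with
    elementary symmetric polynomials. For the lower bounds it is a multiple of the second elementary
    symmetric function, kept in the Weierstrass inequality [prod (1 - u) >= 1 - sum u]. A second
    obstacle is that late approximants are known to be free of zeros only on intervals on which the
    limit is positive, hence only up to radii [r < w]; the inequalities at [w] itself are reached by
    continuity from the left. *)

(* Elementary symmetric polynomials of [s]: the coefficients of [prod_(p in s) (1 + p x)]. *)
Fixpoint elsym (s : list R) (k : nat) : R :=
  match s, k with
  | nil, O => 1
  | nil, S _ => 0
  | p :: s', O => elsym s' O
  | p :: s', S j => elsym s' (S j) + p * elsym s' j
  end.

(* Truncated subtraction makes this vanish for [n < k]. *)
Fixpoint qfall (q : R) (n k : nat) : R :=
  match k with
  | O => 1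
  | S j => qfall q n j * (1 - q ^ (n - j))
  end.

Module RealRooted.
From mathcomp Require Import all_boot all_order all_algebra.
From mathcomp Require Import complex ring lra.
Import Order.TTheory GRing.Theory Num.Theory.
Set Implicit Arguments.
Unset Strict Implicit.
Local Open Scope ring_scope.
Local Open Scope complex_scope.

(** Normalised at 0 rather than by the leading coefficient, so that products with more and more
    factors can converge. The parameters are the negated reciprocals of the zeros. *)
Definition lin_prod {R : comNzRingType} (s : seq R) : {poly R} :=
  \prod_(p <- s) (1 + p *: 'X).

Lemma lin_prod_cons (R : comNzRingType) (x : R) s :
  lin_prod (x :: s) = (1 + x *: 'X) * lin_prod s.
Proof. by rewrite /lin_prod big_cons. Qed.

Lemma lin_prod_coef0 (R : comNzRingType) (s : seq R) : (lin_prod s)`_0 = 1.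
Proof.
rewrite -horner_coef0 /lin_prod; elim: s => [|x s IH]; first by rewrite big_nil hornerC.
by rewrite big_cons hornerM IH !hornerE ?mulr0 ?addr0.
Qed.

Definition evalC {R : rcfType} (p : {poly R}) (z : R[i]) : R[i] :=
  (map_poly (real_complex R) p).[z].

Section EvalC.
Context {R : rcfType} (z : R[i]).
Implicit Types p r : {poly R}.

Lemma evalCM p r : evalC (p * r) z = evalC p z * evalC r z.
Proof. by rewrite /evalC rmorphM hornerM. Qed.

Lemma evalCD p r : evalC (p + r) z = evalC p z + evalC r z.
Proof. by rewrite /evalC rmorphD hornerD. Qed.

Lemma evalCN p : evalC (- p) z = - evalC p z.
Proof. by rewrite /evalC rmorphN hornerN. Qed.

Lemma evalCC a : evalC a%:P z = a%:C.
Proof. by rewrite /evalC map_polyC hornerC. Qed.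

Lemma evalCX : evalC 'X z = z.
Proof. by rewrite /evalC map_polyX hornerX. Qed.

Lemma evalCZ a p : evalC (a *: p) z = a%:C * evalC p z.
Proof. by rewrite -mul_polyC evalCM evalCC. Qed.

Lemma evalC1 : evalC 1 z = 1.
Proof. by rewrite -[1]/(1%:P) evalCC. Qed.

Lemma evalC0 : evalC 0 z = 0.
Proof. by rewrite -[0]/(0%:P) evalCC. Qed.

End EvalC.

Definition evalCE := (@evalCM, @evalCD, @evalCN, @evalCZ, @evalCX, @evalC1, @evalC0, @evalCC).

(** Excludes zeros on the closed positive half-line, so that a real zero in [real_rooted_factor] is
    [-1/x] with [x > 0]. *)
Lemma nonneg_coef_horner_ge1 (R : rcfType) (p : {poly R}) (x : R) :
  p`_0 = 1 -> (forall k, 0 <= p`_k) -> 0 <= x -> 1 <= p.[x].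
Proof.
move=> p0 pk x0; rewrite horner_coef.
have sp : (0 < size p)%N.
  by rewrite size_poly_gt0; apply/eqP => e; move: p0; rewrite e coef0 => /eqP; rewrite eq_sym oner_eq0.
case: (size p) sp => // m _.
rewrite big_ord_recl /= p0 expr0 mulr1 lerDl.
by apply: sumr_ge0 => i _; rewrite mulr_ge0 // exprn_ge0.
Qed.

(** The polynomial splits over the algebraically closed field [R[i]]; its zeros are real by
    hypothesis and negative because the coefficients are nonnegative. Each [X + 1/x] is [1/x] times
    [1 + x X], and comparing constant terms shows that the collected scalar is 1. *)
Lemma real_rooted_factor (R : rcfType) (p : {poly R}) :
  p`_0 = 1 -> (forall k, 0 <= p`_k) ->
  (forall z : R[i], complex.Im z != 0 -> evalC p z != 0) ->
  exists s : seq R, all (fun x => 0 < x) s /\ p = lin_prod s.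
Proof.
move=> p0 pk pz.
have [r pr] := closed_field_poly_normal (map_poly (real_complex R) p).
have pN0 : p != 0 by apply/eqP => e; move: p0; rewrite e coef0 => /eqP; rewrite eq_sym oner_eq0.
have root_neg : forall z, z \in r -> exists2 x : R, 0 < x & z = (- x^-1)%:C.
  move=> z zr.
  have ez : evalC p z = 0.
    by apply/eqP; rewrite -/(root _ z) pr rootZ ?lead_coef_eq0 ?map_poly_eq0 // root_prod_XsubC.
  have iz : complex.Im z = 0 by apply/eqP/negP => /negP h; move: (pz z h); rewrite ez eqxx.
  have zE : z = (complex.Re z)%:C by case: z iz {zr ez} => a b /= ->.
  have rn : complex.Re z < 0.
    rewrite ltNge; apply/negP => h; have := nonneg_coef_horner_ge1 p0 pk h.
    move: ez; rewrite zE /evalC horner_map /= => -[->].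
    by rewrite ler10.
  exists (- (complex.Re z)^-1); first by rewrite oppr_gt0 invr_lt0.
  by rewrite invrN invrK opprK.
have [s [sp sr]] : exists s : seq R, all (fun x => 0 < x) s /\ r = [seq (- x^-1)%:C | x <- s].
  elim: r {pr} root_neg => [|z r IH] h; first by exists nil.
  have [x x0 zx] := h z (mem_head _ _).
  have [s [sp sr]] : exists s : seq R, all (fun x => 0 < x) s /\ r = [seq (- x^-1)%:C | x <- s].
    by apply: IH => y yr; apply: h; rewrite inE yr orbT.
  by exists (x :: s); rewrite /= x0 sp sr zx.
exists s; split => //.
have pE : p = lead_coef p *: \prod_(x <- s) ('X - (- x^-1)%:P).
  apply: (map_poly_inj (real_complex R)).
  rewrite [LHS]pr lead_coef_map sr /= linearZ /= rmorph_prod big_map; congr (_ *: _).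
  by apply: eq_bigr => x _; rewrite rmorphB /= map_polyX map_polyC.
have [d dE] : exists d, \prod_(x <- s) ('X - (- x^-1)%:P) = d *: lin_prod s.
  elim: s sp {sr pE} => [|x s IH] /=; first by exists 1; rewrite /lin_prod !big_nil scale1r.
  move=> /andP[x0 /IH[d dE]]; exists (x^-1 * d); rewrite /lin_prod !big_cons dE.
  have -> : 'X - (- x^-1)%:P = x^-1 *: (1 + x *: 'X) :> {poly R}.
    by rewrite scalerDr scalerA mulVf ?gt_eqF // scale1r polyCN opprK addrC alg_polyC.
  by rewrite -scalerAl -scalerAr scalerA.
have e1 : lead_coef p * d = 1 by rewrite -p0 [in RHS]pE dE scalerA coefZ lin_prod_coef0 mulr1.
by rewrite [LHS]pE dE scalerA e1 scale1r.
Qed.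

Lemma lin_prod_eval_neq0 (R : rcfType) (s : seq R) (z : R[i]) :
  all (fun x => 0 < x) s -> complex.Im z != 0 -> evalC (lin_prod s) z != 0.
Proof.
rewrite /lin_prod => sp z0; elim: s sp => [|x s IH] /=.
  by rewrite big_nil evalC1 oner_eq0.
move=> /andP[x0 /IH h]; rewrite big_cons evalCM mulf_neq0 // !evalCE.
case: z z0 {h IH} => a b /= b0; simpc; rewrite eq_complex /=.
by rewrite negb_and mulf_neq0 ?orbT // gt_eqF.
Qed.

(** [w] is [|p(z)|^2 Im z] times the imaginary part of [z p'(z) / p(z)]. A factor contributes
    [x z / (1 + x z)] to this quotient, with imaginary part [x Im z / |1 + x z|^2]; clearing
    denominators keeps the induction polynomial. Only the empty product has no contribution. *)
Lemma lin_prod_log_deriv (R : rcfType) (s : seq R) (z : R[i]) :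
  all (fun x => 0 < x) s -> complex.Im z != 0 ->
  let w := complex.Im z * complex.Im (z * evalC ((lin_prod s)^`()) z * (evalC (lin_prod s) z)^*) in
  if s is [::] then w = 0 else 0 < w.
Proof.
move=> sp z0; elim: s sp => [|x s IH] /=.
  by rewrite /lin_prod big_nil derivC evalC0 mulr0 mul0r mulr0.
move=> /andP[x0 sp]; move: (IH sp) (lin_prod_eval_neq0 sp z0).
rewrite lin_prod_cons derivM derivD derivC add0r derivZ derivX.
rewrite !evalCE.
set u := evalC (lin_prod s) z; set v := evalC ((lin_prod s)^`()) z.
move: u v => [a b] [c d]; clear IH; case: z z0 => y t /= t0 h n0.
have ab : 0 < a ^+ 2 + b ^+ 2.
  rewrite lt_def addr_ge0 ?sqr_ge0 // andbT paddr_eq0 ?sqr_ge0 // !sqrf_eq0.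
  by move: n0; rewrite eq_complex.
have t2 : 0 < t ^+ 2 by rewrite lt_def sqr_ge0 sqrf_eq0 t0.
have hw : 0 <= t * ((y * c - t * d) * - b + (y * d + t * c) * a).
  by case: (s) h => [->|? ? /ltW].
simpc => /=.
set w := (X in 0 < X).
have -> : w = x * t ^+ 2 * (a ^+ 2 + b ^+ 2) + ((1 + x * y) ^+ 2 + (x * t) ^+ 2) *
   (t * ((y * c - t * d) * - b + (y * d + t * c) * a)) by rewrite /w; ring.
apply: ltr_wpDr; first by rewrite mulr_ge0 // addr_ge0 ?sqr_ge0.
exact: mulr_gt0 (mulr_gt0 x0 t2) ab.
Qed.

(* Laguerre's theorem on [u p(u^2)]: the zeros of [p + 2 x p'] stay real because
   [x p'(x) / p(x)] has nonzero imaginary part off the real axis. *)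
Lemma laguerre_factor (R : rcfType) (s : seq R) :
  all (fun x => 0 < x) s ->
  exists t : seq R, all (fun x => 0 < x) t /\
    forall k, (lin_prod t)`_k = (k.*2.+1)%:R * (lin_prod s)`_k.
Proof.
move=> sp; set p := lin_prod s.
have pk : forall k, 0 <= p`_k.
  rewrite /p; elim: s sp {p} => [|x s IH] /= sp k.
    by rewrite /lin_prod big_nil coef1 ler0n.
  move: sp => /andP[x0 /IH h]; rewrite lin_prod_cons mulrDl mul1r coefD -scalerAl coefZ coefXM addr_ge0 // mulr_ge0 ?(ltW x0) //.
  by case: ifP.
have p0 : p`_0 = 1 by exact: lin_prod_coef0.
pose g := p + ('X * p^`()) *+ 2.
have gk k : g`_k = (k.*2.+1)%:R * p`_k.
  rewrite /g coefD coefMn coefXM; case: k => [|k] /=; first by rewrite mul0rn addr0 mul1r.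
  rewrite coef_deriv -mulrnA -[X in X + _]mulr1n -mulrnDr mulr_natl; congr (_ *+ _).
  by rewrite muln2 add1n.
have [t [tp gt]] : exists t : seq R, all (fun x => 0 < x) t /\ g = lin_prod t.
  apply: real_rooted_factor => [|k|z z0].
  - by rewrite gk p0 mulr1.
  - by rewrite gk mulr_ge0.
  have h := lin_prod_log_deriv sp z0; move: h => /=.
  rewrite -/p; case sE: s => [|x s'].
    move=> _; rewrite /g /p sE /lin_prod big_nil derivC mulr0 mul0rn addr0.
    by rewrite evalC1 oner_eq0.
  move=> h; apply/eqP => e; move: h.
  (* The equation [p + 2 z p' = 0] times the conjugate of [p(z)]: as [|p(z)|^2] is real, the second
     term is real too, against [lin_prod_log_deriv]. *)
  have e2 : evalC p z * (evalC p z)^* + (z * evalC (p^`()) z * (evalC p z)^*) *+ 2 = 0.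
    transitivity (evalC g z * (evalC p z)^*); last by rewrite e mul0r.
    by rewrite /g mulr2n !evalCE; ring.
  move: e2; set u := evalC p z; set v := z * _ * _.
  case: u v => [a b] [c d] /=; rewrite mulr2n => -[e1 e2].
  have -> : d = 0 by move: e2; rewrite mulrN mulrC addNr add0r; lra.
  by rewrite mulr0 ltxx.
by exists t; split => // k; rewrite -gt gk.
Qed.

(** * Three-term recurrence of the rescaled q-Laguerre polynomials *)

Section QLaguerre.
Context (R : rcfType) (q Q c : R) (b : nat -> R).
Hypotheses (q0 : 0 < q) (q1 : q < 1) (Q0 : 0 < Q) (Q1 : Q < 1) (c0 : 0 < c).
Hypotheses (b0 : b 0%N = 1)
  (bS : forall k, b k.+1 * ((1 - q ^+ k.+1) * (1 - Q * q ^+ k)) = q ^+ k.*2 * c * b k).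

(** The counterpart of [qfall] over a real closed field; [qfallE] identifies the two. *)
Fixpoint ff (n k : nat) : R := if k is k'.+1 then ff n k' * (1 - q ^+ (n - k')) else 1.

Lemma ffSS n k : ff n.+1 k.+1 = (1 - q ^+ n.+1) * ff n k.
Proof.
elim: k => [|k IH]; first by rewrite /= subn0 mul1r mulr1.
by rewrite [LHS]/= -[ff n.+1 k * _]/(ff n.+1 k.+1) IH subSS mulrA.
Qed.

Lemma ff_gt n k : (n < k)%N -> ff n k = 0.
Proof.
elim: k => // k IH; rewrite ltnS leq_eqVlt => /orP[/eqP ->|/IH /= ->]; last by rewrite mul0r.
by rewrite /= subnn expr0 subrr mulr0.
Qed.

Lemma expq_lt1 n : (0 < n)%N -> 0 < 1 - q ^+ n.
Proof. by move=> n0; rewrite subr_gt0 exprn_ilt1 ?ltW // -lt0n. Qed.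

Lemma expq_le1 n : q ^+ n <= 1.
Proof. by rewrite exprn_ile1 ?ltW. Qed.

Lemma Qexpq_lt1 n : 0 < 1 - Q * q ^+ n.
Proof. by rewrite subr_gt0 (le_lt_trans _ Q1) // ler_piMr ?expq_le1 ?ltW. Qed.

Lemma ff_ge0 n k : 0 <= ff n k.
Proof. by elim: k => [|k IH] /=; rewrite ?ler01 // mulr_ge0 // subr_ge0 expq_le1. Qed.

Lemma b_gt0 k : 0 < b k.
Proof.
elim: k => [|k IH]; first by rewrite b0.
have h : 0 < (1 - q ^+ k.+1) * (1 - Q * q ^+ k) by rewrite mulr_gt0 ?expq_lt1 ?Qexpq_lt1.
by rewrite -(pmulr_lgt0 _ h) bS !mulr_gt0 // exprn_gt0.
Qed.

(* q-Laguerre polynomials, rescaled and with [x] replaced by [- x]. *)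
Definition qlag n : {poly R} := \poly_(k < n.+1) (ff n k * b k).

Lemma coef_qlag n k : (qlag n)`_k = ff n k * b k.
Proof. by rewrite coef_poly ltnS; case: leqP => // h; rewrite ff_gt // mul0r. Qed.

Lemma qlag0 : qlag 0 = 1.
Proof.
apply/polyP => k; rewrite coef_qlag coef1; case: k => [|k] /=; first by rewrite b0 mulr1.
by rewrite sub0n expr0 subrr mulr0 mul0r.
Qed.

Lemma qlag1 : (1 - Q) *: qlag 1 = (1 - Q)%:P + c *: 'X.
Proof.
apply/polyP => k; rewrite coefD coefC !coefZ coef_qlag coefX.
case: k => [|[|k]] /=; rewrite ?b0 ?mulr1 ?mulr0 ?addr0 ?add0r //.
  have := bS 0; rewrite /= b0 !expr0 expr1 !mulr1 !mul1r => <-.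
  by ring.
by rewrite (_ : (1 - k.+1)%N = 0%N) // expr0 subrr mulr0 mul0r mulr0.
Qed.

(** Compared coefficient by coefficient: [ffSS] makes every term a multiple of [ff n.+1 k], and [bS]
    trades [b k] for [b k.+1]. What [qlag_im] uses are the signs: the factors of [qlag n.+2] and of
    ['X] are positive, and [qlag n] is subtracted with a positive factor. *)
Lemma qlag_rec n : (1 - Q * q ^+ n.+1) *: qlag n.+2 =
  ((1 + q - q ^+ n.+2 - Q * q ^+ n.+1)%:P + (q ^+ (n.+1).*2 * c) *: 'X) * qlag n.+1
  - (q * (1 - q ^+ n.+1)) *: qlag n.
Proof.
apply/polyP => k; rewrite mulrDl coefB coefD !coefZ coefCM -scalerAl coefZ coefXM !coef_qlag.
case: k => [|k] /=; first by rewrite b0 [q ^+ n.+2]exprS; ring.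
rewrite -[ff n.+2 k * _]/(ff n.+2 k.+1) -[ff n.+1 k * (_ - _)]/(ff n.+1 k.+1)
  -[ff n k * _]/(ff n k.+1).
have e1 : q * (1 - q ^+ n.+1) * (ff n k.+1 * b k.+1) = q * ff n.+1 k.+2 * b k.+1.
  by rewrite ffSS; ring.
rewrite e1 ffSS /=.
case: (leqP k n.+1) => [kn|kn]; last by rewrite ff_gt //; ring.
(* At [k = n.+1] the factor [1 - q ^+ 0] kills every term on the right except the one with ['X]. *)
have [kn'|kn'] := leqP k n; last first.
  have -> : k = n.+1 by apply/eqP; rewrite eqn_leq kn kn'.
  rewrite !subnn !expr0 !subrr.
  have := bS n.+1 => h.
  transitivity (ff n.+1 n.+1 * (b n.+2 * ((1 - q ^+ n.+2) * (1 - Q * q ^+ n.+1)))); first by ring.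
  by rewrite h; ring.
have [m nE] : exists m, n = (m + k)%N by exists (n - k)%N; rewrite subnK.
have E1 : (n.+1 - k = m.+1)%N by rewrite nE -addSn addnK.
have E2 : (n.+1 - k.+1 = m)%N by rewrite subSS nE addnK.
rewrite E1 E2.
have nz : q ^+ k.*2 != 0 by rewrite expf_neq0 // gt_eqF.
have h : q ^+ (n.+1).*2 * c * b k = (q ^+ m.+1) ^+ 2 * (b k.+1 * ((1 - q ^+ k.+1) * (1 - Q * q ^+ k))).
  rewrite bS; have -> : (n.+1).*2 = ((m.+1).*2 + k.*2)%N by rewrite -doubleD nE addSn.
  by rewrite exprD -!exprM muln2; ring.
transitivity (ff n.+1 k * (b k.+1 * ((1 - Q * q ^+ n.+1) * (1 - q ^+ n.+2)))); first by ring.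
set A := (1 + q - _ - _).
transitivity (A * (ff n.+1 k * (1 - q ^+ m.+1) * b k.+1) + ff n.+1 k * (q ^+ (n.+1).*2 * c * b k) -
  q * (ff n.+1 k * (1 - q ^+ m.+1) * (1 - q ^+ m) * b k.+1)); last by ring.
rewrite h /A nE -!addSn !exprD [q ^+ k.+1]exprS [q ^+ m.+2]exprS [q ^+ m.+1]exprS.
by ring.
Qed.

(* By the recurrence, [P_{n+1} / P_n] maps the upper half plane into itself. *)
Lemma qlag_im (z : R[i]) : complex.Im z != 0 -> forall n,
  0 < complex.Im z * complex.Im (evalC (qlag n.+1) z * (evalC (qlag n) z)^*).
Proof.
move=> z0; elim=> [|n IH].
  have : evalC ((1 - Q) *: qlag 1) z = evalC ((1 - Q)%:P + c *: 'X) z by rewrite qlag1.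
  rewrite qlag0 !evalCE.
  set u := evalC _ _; move: u => [u v]; case: z z0 => [x y] /= y0; simpc => -[e1 e2].
  have h : (1 - Q) * (y * v) = c * y ^+ 2 by rewrite mulrCA e2; ring.
  have Q1' : 0 < 1 - Q by rewrite subr_gt0.
  rewrite -(pmulr_rgt0 _ Q1').
  by rewrite h mulr_gt0 // lt_def sqr_ge0 sqrf_eq0 y0.
have : evalC ((1 - Q * q ^+ n.+1) *: qlag n.+2) z =
   evalC (((1 + q - q ^+ n.+2 - Q * q ^+ n.+1)%:P + (q ^+ (n.+1).*2 * c) *: 'X) * qlag n.+1
  - (q * (1 - q ^+ n.+1)) *: qlag n) z by rewrite qlag_rec.
have hA : 0 < 1 - Q * q ^+ n.+1 by exact: Qexpq_lt1.
have hB : 0 < q ^+ (n.+1).*2 * c by rewrite mulr_gt0 // exprn_gt0.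
have hC : 0 < q * (1 - q ^+ n.+1) by rewrite mulr_gt0 // expq_lt1.
move: hA hB hC; set A := 1 - _; set B := _ * c; set C := q * _; set D := 1 + q - _ - _.
move=> hA hB hC.
rewrite !evalCE; move: IH.
set u := evalC (qlag n) z; set v := evalC (qlag n.+1) z; set w := evalC (qlag n.+2) z.
move: u v w z0 => [u1 u2] [v1 v2] [w1 w2]; case: z => [x y] /= y0 IH; simpc => -[e1 e2].
have vv : 0 < v1 ^+ 2 + v2 ^+ 2.
  rewrite lt_def addr_ge0 ?sqr_ge0 // andbT paddr_eq0 ?sqr_ge0 // !sqrf_eq0.
  by apply/negP => /andP[/eqP h1 /eqP h2]; move: IH; rewrite h1 h2 !mul0r addr0 mulr0 ltxx.
have y2 : 0 < y ^+ 2 by rewrite lt_def sqr_ge0 sqrf_eq0 y0.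
rewrite -(pmulr_rgt0 _ hA).
set g := (X in 0 < X).
have -> : g = y * ((A * w1) * - v2 + (A * w2) * v1) by rewrite /g; ring.
rewrite e1 e2.
(* The middle coefficient [D] is real and multiplies [|P_(n+1)|^2], so it drops out of the imaginary
   part. Conjugation turns the subtracted term into [C] times the induction hypothesis. *)
set g' := (X in 0 < X).
have -> : g' = B * y ^+ 2 * (v1 ^+ 2 + v2 ^+ 2) + C * (y * (v1 * - u2 + v2 * u1)).
  by rewrite /g'; ring.
by rewrite addr_gt0 // mulr_gt0 // mulr_gt0.
Qed.

(** A zero off the real axis would make the positive quantity of [qlag_im] vanish. *)
Lemma qlag_factor n : exists s : seq R, all (fun x => 0 < x) s /\ qlag n = lin_prod s.
Proof.
apply: real_rooted_factor => [|k|z z0].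
- by rewrite coef_qlag b0 mulr1.
- by rewrite coef_qlag mulr_ge0 ?ff_ge0 // ltW // b_gt0.
have := qlag_im z0 n; apply: contraTneq => ->.
by rewrite rmorph0 mulr0 /= mulr0 ltxx.
Qed.

End QLaguerre.
From mathcomp Require Import Rstruct.

Lemma elsymE (s : seq R) k : elsym s k = (lin_prod s)`_k.
Proof.
elim: s k => [|p s IH] k; first by rewrite /lin_prod big_nil coef1; case: k.
rewrite lin_prod_cons mulrDl mul1r coefD -scalerAl coefZ coefXM -IH.
by case: k => [|k] /=; rewrite ?mulr0 ?addr0 // RplusE RmultE -IH.
Qed.

Lemma qfallE (q : R) n k : qfall q n k = ff q n k.
Proof. by elim: k => //= k ->; rewrite RpowE. Qed.

Lemma all_Forall (s : seq R) : all (fun x => 0 < x) s -> List.Forall (Rlt (IZR 0)) s.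
Proof.
by elim: s => [|x s IH] /= => [_|/andP[/RltP h /IH]]; constructor.
Qed.

Local Open Scope R_scope.

(** Both lists come from one truncation, so their symmetric polynomials carry the same damping
    [qfall q n k] relative to the limit coefficients. This is used with [c = Q / 4]. *)
Lemma qlaguerre_real_rooted (q Q c : R) (b : nat -> R) :
  0 < q < 1 -> 0 < Q < 1 -> 0 < c -> b O = 1 ->
  (forall k, b (S k) * ((1 - q ^ S k) * (1 - Q * q ^ k)) = q ^ (2 * k)%coq_nat * c * b k) ->
  forall n, exists s t : list R,
    List.Forall (Rlt 0) s /\ List.Forall (Rlt 0) t /\
    (forall k, elsym s k = qfall q n k * b k) /\
    (forall k, elsym t k = INR (2 * k + 1)%coq_nat * elsym s k).
Proof.
move=> [/RltP q0 /RltP q1] [/RltP Q0 /RltP Q1] /RltP c0 b0 bS n.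
have bS' k : (b k.+1 * ((1 - q ^+ k.+1) * (1 - Q * q ^+ k)) = q ^+ k.*2 * c * b k)%R.
  by have := bS k; rewrite !RpowE multE mul2n.
have [s [sp sE]] := qlag_factor q0 q1 Q0 Q1 c0 b0 bS' n.
have [t [tp tE]] := laguerre_factor sp.
exists s, t; split; [exact: all_Forall|split; [exact: all_Forall|split => k]].
  by rewrite elsymE -sE (coef_qlag q b) qfallE.
by rewrite !elsymE tE INRE -addn1 -mul2n.
Qed.
End RealRooted.

(** * Power sums and elementary symmetric polynomials *)

Fixpoint psum (g : R -> R) (s : list R) : R :=
  match s with nil => 0 | p :: s' => g p + psum g s' end.

Definition pow_sum (m : nat) : list R -> R := psum (fun p => p ^ m).

(* [wsum g s k] is the sum over [p] in [s] of [g p] times the [k]-th elementary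
   symmetric polynomial of [s] without [p]. *)
Fixpoint wsum (g : R -> R) (s : list R) (k : nat) : R :=
  match s with
  | nil => 0
  | p :: s' => g p * elsym s' k + wsum g s' k
               + match k with O => 0 | S j => p * wsum g s' j end
  end.

Lemma elsym_0 (s : list R) : elsym s 0 = 1.
Proof. induction s; simpl; auto. Qed.

Lemma elsym_ge0 (s : list R) k : Forall (Rlt 0) s -> 0 <= elsym s k.
Proof.
  intros H; revert k; induction H as [|p s Hp _ IH]; intros [|k]; simpl; try lra; auto.
  specialize (IH (S k)) as H1; specialize (IH k); nra.
Qed.

Lemma psum_ext g h s : (forall p, g p = h p) -> psum g s = psum h s.
Proof. intros E; induction s; simpl; rewrite ?E, ?IHs; auto. Qed.

Lemma psum_minus_scal g h r s :
  psum (fun p => g p - r * h p) s = psum g s - r * psum h s.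
Proof. induction s as [|p s IH]; simpl; [ring|rewrite IH; ring]. Qed.

Lemma wsum_minus_scal g h r s k :
  wsum (fun p => g p - r * h p) s k = wsum g s k - r * wsum h s k.
Proof.
  revert k; induction s as [|p s IH]; intros [|k]; simpl; rewrite ?IH; ring.
Qed.

Lemma wsum_ext g h s k : (forall p, g p = h p) -> wsum g s k = wsum h s k.
Proof. intros E; revert k; induction s as [|p s IH]; intros [|k]; simpl; rewrite ?E, ?IH; auto. Qed.

(** For positive entries, removing [p] from [s] can only decrease the symmetric polynomials. *)
Lemma wsum_le g s k :
  Forall (fun p => 0 < p /\ 0 <= g p) s -> 0 <= wsum g s k <= psum g s * elsym s k.
Proof.
  intros H; revert k; induction H as [|p s [Hp Hg] Hs IH]; intros k; simpl; [lra|].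
  assert (Hs' : Forall (Rlt 0) s) by (eapply Forall_impl; [|exact Hs]; intros a Ha; apply Ha).
  pose proof (elsym_ge0 s) as He.
  destruct k as [|k].
  - specialize (IH O); specialize (He O Hs'); nra.
  - pose proof (IH (S k)); pose proof (IH k); pose proof (He (S k) Hs'); pose proof (He k Hs').
    assert (0 <= psum g s) by (clear -Hs; induction Hs; simpl; lra).
    assert (0 <= p * wsum g s k <= p * (psum g s * elsym s k)) by nra.
    assert (0 <= g p * (p * elsym s k)) by (apply Rmult_le_pos; nra).
    nra.
Qed.

(** Sums [e_(k+1)(s) = e_(k+1)(s - p) + p e_k(s - p)] over [p] with weights [g p]. Starting from
    [wsum_id], it raises the power of the weight and gives Newton-type identities in every
    degree. *)
Lemma wsum_mul_id g s k :
  wsum (fun p => p * g p) s k + wsum g s (S k) = psum g s * elsym s (S k).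
Proof.
  revert k; induction s as [|p s IH]; intros k; simpl; [ring|].
  pose proof (IH k) as H1. destruct k as [|k].
  - simpl. assert (H0 : wsum g s 0 = psum g s * elsym s 0).
    { clear; induction s as [|a s IH]; simpl; [ring|rewrite IH; ring]. }
    rewrite H0; nra.
  - pose proof (IH k); nra.
Qed.

(** Every product of [k + 1] entries is counted once for each of its factors. *)
Lemma wsum_id s k : wsum (fun p => p) s k = INR (S k) * elsym s (S k).
Proof.
  revert k; induction s as [|p s IH]; intros k; [simpl; ring|].
  change (p * elsym s k + wsum (fun p => p) s k +
    match k with O => 0 | S j => p * wsum (fun p => p) s j end
    = INR (S k) * (elsym s (S k) + p * elsym s k)).
  rewrite IH; destruct k as [|k]; [simpl; ring|].
  rewrite IH, !S_INR; ring.
Qed.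

Lemma wsum_sq s k :
  wsum (fun p => p ^ 2) s k = elsym s 1 * elsym s (S k) - INR (S (S k)) * elsym s (S (S k)).
Proof.
  pose proof (wsum_mul_id (fun p => p) s k) as H.
  rewrite wsum_id in H.
  assert (E : psum (fun p => p) s = elsym s 1).
  { clear; induction s as [|p s IH]; simpl; [ring|rewrite IH, elsym_0; ring]. }
  rewrite E in H; rewrite (wsum_ext _ (fun p => p * p)) by (intros; ring); lra.
Qed.

Lemma pow_sum_1 s : pow_sum 1 s = elsym s 1.
Proof. induction s as [|p s IH]; unfold pow_sum in *; simpl in *; rewrite ?IH, ?elsym_0; ring. Qed.

Lemma pow_sum_2 s : pow_sum 2 s = elsym s 1 ^ 2 - 2 * elsym s 2.
Proof.
  induction s as [|p s IH]; unfold pow_sum in *; [simpl; ring|].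
  simpl in *; rewrite IH, elsym_0; ring.
Qed.

Lemma pow_sum_3 s : pow_sum 3 s = elsym s 1 ^ 3 - 3 * elsym s 1 * elsym s 2 + 3 * elsym s 3.
Proof.
  induction s as [|p s IH]; unfold pow_sum in *; [simpl; ring|].
  simpl in *; rewrite IH, elsym_0; ring.
Qed.

Lemma wsum_cube s k :
  wsum (fun p => p ^ 3) s k = pow_sum 2 s * elsym s (S k)
    - elsym s 1 * elsym s (S (S k)) + INR (S (S (S k))) * elsym s (S (S (S k))).
Proof.
  pose proof (wsum_mul_id (fun p => p ^ 2) s k) as H.
  rewrite wsum_sq in H; fold (pow_sum 2 s) in H.
  rewrite (wsum_ext _ (fun p => p * p ^ 2)) by (intros; ring); lra.
Qed.

(** For large [k] the limit of the left-hand side is positive, which keeps the limit of [pow_sum 2]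
    away from 0. *)
Lemma pow_sum_2_lower s k : Forall (Rlt 0) s ->
  elsym s 1 * elsym s (S k) - INR (S (S k)) * elsym s (S (S k)) <= pow_sum 2 s * elsym s k.
Proof.
  intros H; rewrite <- wsum_sq; apply wsum_le.
  eapply Forall_impl; [|exact H]; simpl; intros p Hp; nra.
Qed.

(** The gap is the sum of the nonnegative weights [p (1 - p r)]. Passing to [wsum] bounds it below
    by an expression in the coefficients, whose sign can be controlled after the limit. [gap2_lower]
    does the same with [p^2 (1 - p r)]. *)
Lemma gap1_lower s r k : Forall (Rlt 0) s -> Forall (fun p => p * r < 1) s ->
  INR (S k) * elsym s (S k) - r * (elsym s 1 * elsym s (S k) - INR (S (S k)) * elsym s (S (S k)))
  <= (pow_sum 1 s - r * pow_sum 2 s) * elsym s k.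
Proof.
  intros H1 H2.
  rewrite <- wsum_sq, <- wsum_id, <- wsum_minus_scal.
  unfold pow_sum; rewrite <- psum_minus_scal.
  rewrite (psum_ext _ (fun p => p - r * p ^ 2)) by (intros; ring).
  apply wsum_le, Forall_forall; intros p Hp.
  rewrite Forall_forall in H1, H2; specialize (H1 p Hp); specialize (H2 p Hp); nra.
Qed.

Lemma gap2_lower s r k : Forall (Rlt 0) s -> Forall (fun p => p * r < 1) s ->
  elsym s 1 * elsym s (S k) - INR (S (S k)) * elsym s (S (S k))
  - r * (pow_sum 2 s * elsym s (S k)
         - elsym s 1 * elsym s (S (S k)) + INR (S (S (S k))) * elsym s (S (S (S k))))
  <= (pow_sum 2 s - r * pow_sum 3 s) * elsym s k.
Proof.
  intros H1 H2.
  rewrite <- wsum_cube, <- wsum_sq, <- wsum_minus_scal.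
  unfold pow_sum; rewrite <- psum_minus_scal.
  apply wsum_le, Forall_forall; intros p Hp.
  rewrite Forall_forall in H1, H2; specialize (H1 p Hp); specialize (H2 p Hp).
  split; [exact H1|].
  replace (p ^ 2 - r * p ^ 3) with (p ^ 2 * (1 - p * r)) by ring.
  apply Rmult_le_pos; nra.
Qed.

Lemma pow_sum_gap s r m : Forall (Rlt 0) s -> Forall (fun p => p * r < 1) s ->
  r * pow_sum (S m) s <= pow_sum m s.
Proof.
  unfold pow_sum; induction s as [|p s IH]; intros H1 H2; simpl; [lra|].
  inversion_clear H1; inversion_clear H2.
  specialize (IH H0 H3); simpl in IH.
  assert (0 < p ^ m) by (apply pow_lt; assumption). nra.
Qed.

(** Cauchy-Schwarz from the quadratic [sum p (p - a)^2], which is nonnegative for every [a]. *)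
Lemma pow_sum_cauchy s : Forall (Rlt 0) s -> pow_sum 2 s ^ 2 <= pow_sum 1 s * pow_sum 3 s.
Proof.
  intros H.
  assert (K : forall a, 0 <= pow_sum 3 s - 2 * a * pow_sum 2 s + a ^ 2 * pow_sum 1 s).
  { intros a; unfold pow_sum; induction H as [|p s Hp _ IH]; simpl; [lra|].
    simpl in IH. pose proof (pow2_ge_0 (p - a)).
    assert (0 <= p * (p - a) ^ 2) by (apply Rmult_le_pos; lra). nra. }
  assert (P1 : 0 <= pow_sum 1 s) by (rewrite pow_sum_1; apply elsym_ge0; exact H).
  destruct (Req_dec (pow_sum 1 s) 0) as [E|E].
  - rewrite E in K |- *.
    destruct (Req_dec (pow_sum 2 s) 0) as [E2|E2]; [rewrite E2; lra|].
    (* Without its leading term the quadratic is affine in [a], and at this [a] it would equal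
       [-1]. *)
    specialize (K ((pow_sum 3 s + 1) / (2 * pow_sum 2 s))).
    replace (2 * ((pow_sum 3 s + 1) / (2 * pow_sum 2 s)) * pow_sum 2 s)
      with (pow_sum 3 s + 1) in K by (field; exact E2). lra.
  - specialize (K (pow_sum 2 s / pow_sum 1 s)).
    apply Rmult_le_compat_l with (r := pow_sum 1 s) in K; [|exact P1].
    rewrite Rmult_0_r in K.
    replace (pow_sum 1 s * _) with (pow_sum 1 s * pow_sum 3 s - pow_sum 2 s ^ 2) in K
      by (field; exact E). lra.
Qed.

(** * Weierstrass product inequality with a surplus *)

Fixpoint gprod (g : R -> R) (s : list R) : R :=
  match s with nil => 1 | p :: s' => (1 - g p) * gprod g s' end.

(** With elementary symmetric functions [e_j] of the values [g p], the left-hand side is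
    [1 - e_1 + (2/3) e_2]. The constant fits the Bonferroni bound [1 - e_1 + e_2 - e_3], because
    [e_3 <= e_1 e_2 / 3 <= e_2 / 3] when [e_1 <= 1]. *)
Lemma gprod_lower g s :
  Forall (fun p => 0 <= g p <= 1) s -> psum g s <= 1 ->
  1 - psum g s + (psum g s ^ 2 - psum (fun p => g p ^ 2) s) / 3 <= gprod g s.
Proof.
  intros H; induction H as [|p s Hp Hs IH]; cbn [psum gprod]; [simpl; lra|intros HS].
  assert (H1 : 0 <= psum g s) by (clear -Hs; induction Hs; simpl; lra).
  assert (H2 : 0 <= psum (fun p => g p ^ 2) s).
  { clear -Hs; induction Hs as [|a l Ha _ IH]; simpl in *; nra. }
  specialize (IH ltac:(lra)); revert H1 H2 IH HS Hp; generalize (g p).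
  generalize (psum g s), (psum (fun p => g p ^ 2) s), (gprod g s).
  intros S T P u H1 H2 IH HS Hu.
  assert ((1 - u) * (1 - S + (S ^ 2 - T) / 3) <= (1 - u) * P)
    by (apply Rmult_le_compat_l; lra).
  (* A third of this is the amount by which [(1 - u)] times the old bound exceeds the new one. *)
  assert (0 <= u * (S - S * S + T)) by (apply Rmult_le_pos; nra).
  nra.
Qed.

Definition rprod (s : list R) (x : R) : R := gprod (fun p => - (p * x)) s.

Lemma rprod_opp s x : rprod s (- x) = gprod (fun p => p * x) s.
Proof. induction s as [|p s IH]; unfold rprod in *; simpl; [reflexivity|rewrite IH; ring]. Qed.

Lemma rprod_lower1 s x : Forall (Rlt 0) s -> Forall (fun p => p * x < 1) s -> 0 <= x ->
  pow_sum 1 s * x <= 1 ->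
  1 - pow_sum 1 s * x + ((pow_sum 1 s * x) ^ 2 - pow_sum 2 s * x ^ 2) / 3 <= rprod s (- x).
Proof.
  intros H1 H2 Hx HS.
  assert (E1 : psum (fun p => p * x) s = pow_sum 1 s * x).
  { clear; unfold pow_sum; induction s as [|p s IH]; simpl in *; [ring|rewrite IH; ring]. }
  assert (E2 : psum (fun p => (p * x) ^ 2) s = pow_sum 2 s * x ^ 2).
  { clear; unfold pow_sum; induction s as [|p s IH]; simpl in *; [ring|rewrite IH; ring]. }
  rewrite rprod_opp, <- E1, <- E2; apply gprod_lower; [|rewrite E1; exact HS].
  rewrite Forall_forall in *; intros p Hp; specialize (H1 p Hp); specialize (H2 p Hp); nra.
Qed.

(** Multiplying the values at [x] and [- x] gives factors [1 - (p x)^2], so the leading sum is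
    [S_2]. As [p x < 1], the fourth powers in the surplus may be replaced by cubes, and [S_3]
    suffices. *)
Lemma rprod_lower2 s x : Forall (Rlt 0) s -> Forall (fun p => p * x < 1) s -> 0 <= x ->
  pow_sum 2 s * x ^ 2 <= 1 ->
  1 - pow_sum 2 s * x ^ 2 + ((pow_sum 2 s * x ^ 2) ^ 2 - pow_sum 3 s * x ^ 3) / 3
  <= rprod s (- x) * rprod s x.
Proof.
  intros H1 H2 Hx HS.
  assert (E1 : psum (fun p => (p * x) ^ 2) s = pow_sum 2 s * x ^ 2).
  { clear; unfold pow_sum; induction s as [|p s IH]; simpl in *; [ring|rewrite IH; ring]. }
  assert (E2 : psum (fun p => ((p * x) ^ 2) ^ 2) s <= pow_sum 3 s * x ^ 3).
  { clear -H1 H2 Hx; unfold pow_sum.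
    induction s as [|p s IH]; [simpl; lra|].
    inversion_clear H1; inversion_clear H2; specialize (IH H0 H3).
    cbn [psum] in *.
    assert (0 <= (p * x) ^ 3) by (apply pow_le; nra).
    assert (((p * x) ^ 2) ^ 2 <= (p * x) ^ 3) by nra. nra. }
  assert (E3 : rprod s (- x) * rprod s x = gprod (fun p => (p * x) ^ 2) s).
  { clear; rewrite rprod_opp; unfold rprod.
    induction s as [|p s IH]; simpl in *; [ring|rewrite <- IH; ring]. }
  rewrite E3, <- E1.
  eapply Rle_trans; [|apply gprod_lower; [|rewrite E1; exact HS]]; [lra|].
  rewrite Forall_forall in *; intros p Hp; specialize (H1 p Hp); specialize (H2 p Hp).
  assert (0 <= p * x) by nra. simpl; nra.
Qed.

(** * Complex series *)

(** Componentwise, because [g2] is a pair of real series. *)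
Definition CSum (u : nat -> C) : C := (Series (fun n => Re (u n)), Series (fun n => Im (u n))).

Definition abs_summable (u : nat -> C) : Prop := ex_series (fun n => Cmod (u n)).

Lemma ex_series_Rabs_le (u v : nat -> R) :
  (forall n, Rabs (u n) <= v n) -> ex_series v -> ex_series u.
Proof. exact (ex_series_le (K := R_AbsRing) (V := R_CompleteNormedModule) u v). Qed.

Lemma Series_zero (a : nat -> R) : (forall n, a n = 0) -> Series a = 0.
Proof.
  intros H; rewrite (Series_ext _ (fun n => 0 * a n)) by (intros n; rewrite H; ring).
  rewrite Series_scal_l; ring.
Qed.

Lemma im_le_Cmod (z : C) : Rabs (Im z) <= Cmod z.
Proof.
  eapply Rle_trans; [|apply Rmax_Cmod]; apply Rmax_r.
Qed.

Lemma abs_summable_Re u : abs_summable u -> ex_series (fun n => Re (u n)).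
Proof. intros H; eapply ex_series_Rabs_le; [|exact H]; intros n; apply re_le_Cmod. Qed.

Lemma abs_summable_Im u : abs_summable u -> ex_series (fun n => Im (u n)).
Proof. intros H; eapply ex_series_Rabs_le; [|exact H]; intros n; apply im_le_Cmod. Qed.

Lemma CSum_ext u v : (forall n, u n = v n) -> CSum u = CSum v.
Proof. intros H; unfold CSum; f_equal; apply Series_ext; intros n; now rewrite H. Qed.

Lemma abs_summable_le u v : (forall n, Cmod (u n) <= v n) -> ex_series v -> abs_summable u.
Proof.
  intros H Hv; eapply ex_series_Rabs_le; [|exact Hv].
  intros n; rewrite Rabs_pos_eq by apply Cmod_ge_0; apply H.
Qed.

Lemma abs_summable_plus u v :
  abs_summable u -> abs_summable v -> abs_summable (fun n => u n + v n)%C.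
Proof.
  intros Hu Hv; eapply abs_summable_le; [intros n; apply Cmod_triangle|].
  now apply (ex_series_plus (V := R_NormedModule)).
Qed.

Lemma abs_summable_scal a u : abs_summable u -> abs_summable (fun n => a * u n)%C.
Proof.
  intros Hu; apply (abs_summable_le _ (fun n => Cmod a * Cmod (u n))).
  - intros n; rewrite Cmod_mult; lra.
  - now apply (ex_series_scal (V := R_NormedModule)).
Qed.

Lemma CSum_plus u v : abs_summable u -> abs_summable v ->
  CSum (fun n => u n + v n)%C = (CSum u + CSum v)%C.
Proof.
  intros Hu Hv; unfold CSum, Cplus; simpl; f_equal.
  - now apply Series_plus; apply abs_summable_Re.
  - now apply Series_plus; apply abs_summable_Im.
Qed.

Lemma CSum_scal a u : abs_summable u -> CSum (fun n => a * u n)%C = (a * CSum u)%C.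
Proof.
  intros Hu; pose proof (abs_summable_Re u Hu) as Hr; pose proof (abs_summable_Im u Hu) as Hi.
  unfold CSum, Cmult; destruct a as [x y]; simpl; f_equal.
  - rewrite <- !Series_scal_l. rewrite <- Series_minus; [reflexivity| |];
      now apply (ex_series_scal (V := R_NormedModule)).
  - rewrite <- !Series_scal_l, <- Series_plus; [reflexivity| |];
      now apply (ex_series_scal (V := R_NormedModule)).
Qed.

Lemma CSum_incr_1 u : abs_summable u -> CSum u = (u O + CSum (fun n => u (S n)))%C.
Proof.
  intros Hu; unfold CSum, Cplus; simpl; f_equal; rewrite Series_incr_1; auto.
  - now apply abs_summable_Re.
  - now apply abs_summable_Im.
Qed.

(* Pairing with the unit vector in the direction of the sum reduces this to real series. *)
Lemma CSum_norm u : abs_summable u -> Cmod (CSum u) <= Series (fun n => Cmod (u n)).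
Proof.
  intros Hu.
  destruct (Req_dec (Cmod (CSum u)) 0) as [E|E].
  { rewrite E; rewrite <- (Series_zero (fun _ => 0)) by reflexivity.
    apply Series_le; [intros n; split; [lra|apply Cmod_ge_0]|exact Hu]. }
  assert (P : 0 < Cmod (CSum u)) by (pose proof (Cmod_ge_0 (CSum u)); lra).
  apply Rmult_le_reg_l with (1 := P).
  set (w := CSum u) in *.
  assert (E2 : Cmod w * Cmod w = Re (CSum (fun n => Cconj w * u n)%C)).
  { rewrite (CSum_scal (Cconj w)) by exact Hu; fold w.
    replace (Cmod w * Cmod w) with (Cmod w ^ 2) by ring.
    rewrite Cmod2_alt; destruct w; simpl; ring. }
  rewrite E2, <- Series_scal_l.
  simpl; apply Rle_trans with (Series (fun n => Rabs (Re (Cconj w * u n)%C))).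
  - assert (Hs : abs_summable (fun n => Cconj w * u n)%C) by now apply abs_summable_scal.
    eapply Rle_trans; [apply Rle_abs|]; apply Series_Rabs.
    eapply ex_series_Rabs_le; [|exact Hs]; intros n.
    rewrite Rabs_Rabsolu; apply re_le_Cmod.
  - apply Series_le.
    + intros n; split; [apply Rabs_pos|].
      eapply Rle_trans; [apply re_le_Cmod|]; rewrite Cmod_mult, Cmod_conj; lra.
    + now apply (ex_series_scal (V := R_NormedModule)).
Qed.

Lemma CSum_RtoC a : CSum (fun n => RtoC (a n)) = RtoC (Series a).
Proof.
  unfold CSum, RtoC; simpl; f_equal. now apply Series_zero.
Qed.

Lemma Cmod_RtoC_pos x : 0 <= x -> Cmod (RtoC x) = x.
Proof. intros; rewrite Cmod_R; now apply Rabs_pos_eq. Qed.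

Lemma Cmod_coef_pow (a : R) (w : C) n : Cmod (RtoC a * w ^ n)%C = Rabs (a * Cmod w ^ n).
Proof.
  rewrite Cmod_mult, Cmod_R, Cmod_pow, Rabs_mult.
  f_equal; symmetry; apply Rabs_pos_eq, pow_le, Cmod_ge_0.
Qed.

(** * Everywhere convergent series with real coefficients *)

Definition entire (c : nat -> R) : Prop := forall x, CV_disk c x.

Lemma entire_CV_radius c x : entire c -> Rbar_lt (Rabs x) (CV_radius c).
Proof.
  intros H. apply Rbar_lt_le_trans with (Rabs x + 1).
  - simpl; lra.
  - unfold CV_radius, Lub_Rbar; destruct ex_lub_Rbar as [l Hl]; simpl.
    apply Hl, H.
Qed.

Lemma entire_le c d : (forall k, Rabs (d k) <= Rabs (c k)) -> entire c -> entire d.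
Proof.
  intros H Hc x; eapply ex_series_Rabs_le; [|apply (Hc x)].
  intros n; rewrite Rabs_Rabsolu, !Rabs_mult.
  apply Rmult_le_compat_r; [apply Rabs_pos|apply H].
Qed.

Lemma entire_of_CV_radius c : CV_radius c = p_infty -> entire c.
Proof. intros H x; apply CV_disk_inside; rewrite H; exact I. Qed.

Lemma CV_radius_of_entire c : entire c -> CV_radius c = p_infty.
Proof.
  intros H; destruct (CV_radius c) as [r| |] eqn:E; auto; exfalso.
  - pose proof (entire_CV_radius c r H) as K; rewrite E in K; simpl in K.
    pose proof (Rle_abs r); lra.
  - pose proof (entire_CV_radius c 0 H) as K; rewrite E in K; exact K.
Qed.

Lemma entire_INR c : entire c -> entire (fun k => INR k * c k).
Proof.
  intros H; apply entire_of_CV_radius.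
  rewrite (CV_radius_ext _ (PS_incr_1 (PS_derive c))).
  - rewrite CV_radius_incr_1, CV_radius_derive; now apply CV_radius_of_entire.
  - intros [|n]; unfold PS_incr_1, PS_derive; simpl; [rewrite Rmult_0_l|]; reflexivity.
Qed.

Lemma entire_abs_summable c w : entire c -> abs_summable (fun n => RtoC (c n) * w ^ n)%C.
Proof.
  intros H; eapply ex_series_ext; [|apply (H (Cmod w))].
  intros n; symmetry; apply Cmod_coef_pow.
Qed.

Definition Ceval (c : nat -> R) (w : C) : C := CSum (fun n => RtoC (c n) * w ^ n)%C.

Lemma Ceval_RtoC c x : Ceval c (RtoC x) = RtoC (PSeries c x).
Proof.
  unfold PSeries; rewrite <- CSum_RtoC; apply CSum_ext; intros n.
  now rewrite RtoC_mult, RtoC_pow.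
Qed.

Lemma Ceval_ext c d w : (forall k, c k = d k) -> Ceval c w = Ceval d w.
Proof. intros H; apply CSum_ext; intros n; now rewrite H. Qed.

Lemma Ceval_plus c d w : entire c -> entire d ->
  Ceval (fun k => c k + d k) w = (Ceval c w + Ceval d w)%C.
Proof.
  intros Hc Hd; unfold Ceval; rewrite <- CSum_plus by now apply entire_abs_summable.
  apply CSum_ext; intros n; rewrite RtoC_plus; ring.
Qed.

Lemma Ceval_scal a c w : entire c -> Ceval (fun k => a * c k) w = (RtoC a * Ceval c w)%C.
Proof.
  intros Hc; unfold Ceval; rewrite <- CSum_scal by now apply entire_abs_summable.
  apply CSum_ext; intros n; rewrite RtoC_mult; ring.
Qed.

Lemma entire_plus c d : entire c -> entire d -> entire (fun k => c k + d k).
Proof. intros Hc Hd x; now apply CV_disk_plus. Qed.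

Lemma entire_scal a c : entire c -> entire (fun k => a * c k).
Proof. intros Hc x; now apply (CV_disk_scal a c x). Qed.

Lemma entire_incr c : entire c -> entire (PS_incr_1 c).
Proof.
  intros H; apply entire_of_CV_radius; rewrite CV_radius_incr_1; now apply CV_radius_of_entire.
Qed.

Lemma Ceval_incr c w : entire c -> Ceval (PS_incr_1 c) w = (w * Ceval c w)%C.
Proof.
  intros Hc; unfold Ceval at 1.
  rewrite CSum_incr_1 by now apply entire_abs_summable, entire_incr.
  unfold Ceval; rewrite <- CSum_scal by now apply entire_abs_summable.
  rewrite (CSum_ext _ (fun n => w * (RtoC (c n) * w ^ n))%C).
  - unfold PS_incr_1; simpl. change zero with 0. ring.
  - intros n; unfold PS_incr_1; rewrite Cpow_S; ring.
Qed.

Lemma Ceval_norm c w : entire c -> Cmod (Ceval c w) <= Series (fun n => Rabs (c n) * Cmod w ^ n).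
Proof.
  intros H; eapply Rle_trans; [apply CSum_norm, entire_abs_summable, H|].
  right; apply Series_ext; intros n; rewrite Cmod_coef_pow, Rabs_mult.
  f_equal; apply Rabs_pos_eq, pow_le, Cmod_ge_0.
Qed.

(** * Finite products and their minimum modulus on discs *)

Fixpoint cprod (s : list R) (w : C) : C :=
  match s with nil => 1%C | p :: s' => ((1 + RtoC p * w) * cprod s' w)%C end.

(* [w] times the derivative of [cprod s] at [w]. *)
Fixpoint cprod_euler (s : list R) (w : C) : C :=
  match s with
  | nil => 0%C
  | p :: s' => (RtoC p * w * cprod s' w + (1 + RtoC p * w) * cprod_euler s' w)%C
  end.

Lemma elsym_cons p s k :
  elsym (p :: s) k = elsym s k + p * PS_incr_1 (elsym s) k.
Proof. destruct k; unfold PS_incr_1; simpl; [change zero with 0; ring|reflexivity]. Qed.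

Lemma entire_elsym s : entire (elsym s).
Proof.
  induction s as [|p s IH].
  - intros x; apply (ex_series_incr_1 (V := R_NormedModule) (fun n => Rabs (elsym nil n * x ^ n))).
    apply (ex_series_ext (fun n => 0 * (/ 2) ^ n)).
    + intros n; simpl; rewrite !Rmult_0_l, Rabs_R0; reflexivity.
    + apply (ex_series_scal (V := R_NormedModule)), ex_series_geom.
      rewrite Rabs_pos_eq; lra.
  - eapply entire_le; [|apply (entire_plus (elsym s) (fun k => p * PS_incr_1 (elsym s) k))].
    + intros k; rewrite elsym_cons; lra.
    + exact IH.
    + now apply entire_scal, entire_incr.
Qed.

Lemma Ceval_elsym s w : Ceval (elsym s) w = cprod s w.
Proof.
  induction s as [|p s IH].
  - unfold Ceval. rewrite CSum_incr_1 by apply entire_abs_summable, entire_elsym.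
    rewrite (CSum_ext _ (fun n => RtoC 0)), CSum_RtoC, Series_zero by (intros; simpl; auto; ring).
    simpl; ring.
  - rewrite (Ceval_ext _ (fun k => elsym s k + p * PS_incr_1 (elsym s) k)) by apply elsym_cons.
    rewrite Ceval_plus, Ceval_scal, Ceval_incr, IH; [simpl; ring|..];
      auto using entire_elsym, entire_incr, entire_scal.
Qed.

Lemma Ceval_INR_elsym s w : Ceval (fun k => INR k * elsym s k) w = cprod_euler s w.
Proof.
  induction s as [|p s IH].
  - rewrite (Ceval_ext _ (fun k => 0 * elsym nil k)) by (intros [|k]; simpl; ring).
    rewrite Ceval_scal by apply entire_elsym; simpl; ring.
  - rewrite (Ceval_ext _ (fun k => INR k * elsym s k +
        p * (PS_incr_1 (fun j => INR j * elsym s j) k + PS_incr_1 (elsym s) k))).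
    + rewrite Ceval_plus, Ceval_scal, Ceval_plus, !Ceval_incr, IH, Ceval_elsym; [simpl; ring|..];
        auto using entire_elsym, entire_incr, entire_scal, entire_plus, entire_INR.
    + intros [|k]; rewrite elsym_cons; unfold PS_incr_1; [simpl; change zero with 0; ring|].
      rewrite S_INR; ring.
Qed.

Lemma cprod_RtoC s x : cprod s (RtoC x) = RtoC (rprod s x).
Proof.
  induction s as [|p s IH]; [reflexivity|].
  unfold rprod in *; cbn [cprod gprod].
  rewrite IH, RtoC_mult, RtoC_minus, RtoC_opp, RtoC_mult; ring.
Qed.

Lemma PSeries_elsym s x : PSeries (elsym s) x = rprod s x.
Proof. apply RtoC_inj; now rewrite <- Ceval_RtoC, Ceval_elsym, cprod_RtoC. Qed.

Lemma PSeries_INR_elsym s x :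
  PSeries (fun k => INR k * elsym s k) x = Re (cprod_euler s (RtoC x)).
Proof. now rewrite <- Ceval_INR_elsym, Ceval_RtoC. Qed.

(** Factor by factor, [|1 + p w| >= 1 - p r] and [|p w / (1 + p w)| <= p r / (1 - p r)], with
    equality at [w = - r]. The second bound, summed over the factors, is the estimate of the
    logarithmic derivative, stated without denominators. *)
Lemma cprod_estimate s r w :
  Forall (Rlt 0) s -> Forall (fun p => p * r < 1) s -> Cmod w <= r ->
  0 < rprod s (- r) <= Cmod (cprod s w) /\
  Cmod (cprod_euler s w) * rprod s (- r) <= - Re (cprod_euler s (RtoC (- r))) * Cmod (cprod s w).
Proof.
  intros H1 H2 Hw; induction s as [|p s IH].
  - unfold rprod; simpl; rewrite Cmod_1, Cmod_0; lra.
  - inversion_clear H1 as [|? ? Hp H1']; inversion_clear H2 as [|? ? Hpr H2'].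
    destruct (IH H1' H2') as [[I1 I2] I3]; clear IH.
    assert (E1 : rprod (p :: s) (- r) = (1 - p * r) * rprod s (- r)).
    { unfold rprod; simpl; ring. }
    assert (E2 : Re (cprod_euler (p :: s) (RtoC (- r))) =
      - (p * r) * rprod s (- r) + (1 - p * r) * Re (cprod_euler s (RtoC (- r)))).
    { cbn [cprod_euler]; rewrite cprod_RtoC.
      destruct (cprod_euler s (RtoC (- r))) as [u v]; unfold RtoC, Re; simpl; ring. }
    rewrite E1, E2.
    simpl cprod; simpl cprod_euler; rewrite !Cmod_mult.
    set (P := rprod s (- r)) in *; set (D := Re (cprod_euler s (RtoC (- r)))) in *.
    set (cp := cprod s w) in *; set (cd := cprod_euler s w) in *.
    assert (Hr : 0 <= r) by (pose proof (Cmod_ge_0 w); lra).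
    assert (L : 1 - p * r <= Cmod (1 + RtoC p * w)%C).
    { assert (T : 1 <= Cmod (1 + RtoC p * w)%C + Cmod (RtoC p * w)%C).
      { rewrite <- Cmod_1 at 1; rewrite <- (Cmod_opp (RtoC p * w)%C).
        eapply Rle_trans; [|apply Cmod_triangle]; right; f_equal; ring. }
      rewrite Cmod_mult, Cmod_RtoC_pos in T by lra.
      assert (p * Cmod w <= p * r) by (apply Rmult_le_compat_l; lra). lra. }
    assert (U : Cmod (RtoC p * w * cp + (1 + RtoC p * w) * cd)%C <=
       p * r * Cmod cp + Cmod (1 + RtoC p * w)%C * Cmod cd).
    { eapply Rle_trans; [apply Cmod_triangle|].
      rewrite !Cmod_mult, Cmod_RtoC_pos by lra.
      assert (p * Cmod w * Cmod cp <= p * r * Cmod cp).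
      { apply Rmult_le_compat_r; [apply Cmod_ge_0|]; apply Rmult_le_compat_l; lra. }
      lra. }
    set (m := Cmod (1 + RtoC p * w)%C) in *; set (a := Cmod cp) in *; set (b := Cmod cd) in *.
    assert (0 <= b) by apply Cmod_ge_0.
    split; [split; [apply Rmult_lt_0_compat; lra|apply Rmult_le_compat; lra]|].
    eapply Rle_trans.
    { apply Rmult_le_compat_r; [apply Rmult_le_pos; lra|exact U]. }
    assert (0 <= p * r) by nra.
    assert (K1 : (1 - p * r) * (p * r * a * P) <= m * (p * r * a * P)).
    { apply Rmult_le_compat_r; [|exact L]. repeat apply Rmult_le_pos; lra. }
    assert (K2 : (m * (1 - p * r)) * (b * P) <= (m * (1 - p * r)) * (- D * a)).
    { apply Rmult_le_compat_l; [apply Rmult_le_pos; lra|exact I3]. }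
    nra.
Qed.

(** * Limits of real-rooted polynomials *)

Lemma tannery (t : nat -> nat -> R) (a : nat -> R) :
  (forall k, 0 <= a k) -> ex_series a -> (forall N k, 0 <= t N k <= 1) ->
  (forall k, is_lim_seq (fun N => t N k) 0) ->
  is_lim_seq (fun N => Series (fun k => t N k * a k)) 0.
Proof.
  intros Ha Hex Ht Hlim.
  assert (Hb : forall N k, 0 <= t N k * a k <= a k).
  { intros N k; specialize (Ha k); specialize (Ht N k); nra. }
  assert (Hexb : forall N, ex_series (fun k => t N k * a k)).
  { intros N; apply (ex_series_Rabs_le _ a); auto.
    intros k; rewrite Rabs_pos_eq; apply Hb. }
  apply is_lim_seq_spec; intros eps.
  assert (Hfin : forall K, is_lim_seq (fun N => sum_f_R0 (fun k => t N k * a k) K) 0).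
  { intros K; induction K as [|K IH]; simpl.
    - rewrite <- (Rmult_0_l (a O)); apply (is_lim_seq_scal_r _ _ (Finite 0)), Hlim.
    - rewrite <- (Rplus_0_l 0); apply is_lim_seq_plus'; [exact IH|].
      rewrite <- (Rmult_0_l (a (S K))); apply (is_lim_seq_scal_r _ _ (Finite 0)), Hlim. }
  pose proof (Series_correct a Hex) as Hs.
  assert (Hs' : is_lim_seq (sum_n a) (Series a)) by exact Hs.
  apply is_lim_seq_spec in Hs'; destruct (Hs' (pos_div_2 eps)) as [K HK].
  specialize (HK K (le_n K)); simpl in HK; rewrite sum_n_Reals in HK.
  specialize (Hfin K); apply is_lim_seq_spec in Hfin; destruct (Hfin (pos_div_2 eps)) as [N0 HN0].
  exists N0; intros N HN; specialize (HN0 N HN); simpl in HN0.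
  pose proof (Series_incr_n a (S K) ltac:(lia) Hex) as E1.
  pose proof (Series_incr_n _ (S K) ltac:(lia) (Hexb N)) as E2.
  simpl pred in E1, E2.
  assert (L : 0 <= Series (fun k => t N (S K + k)%nat * a (S K + k)%nat) <= Series (fun k => a (S K + k)%nat)).
  { split.
    - rewrite <- (Series_zero (fun _ => 0)) by reflexivity; apply Series_le.
      + intros n; split; [lra|apply Hb].
      + apply (ex_series_incr_n (V := R_NormedModule) (fun k => t N k * a k) (S K)), Hexb.
    - apply Series_le; [intros n; apply Hb|].
      now apply (ex_series_incr_n (V := R_NormedModule) a (S K)). }
  assert (0 <= sum_f_R0 (fun k => t N k * a k) K) by (apply cond_pos_sum; intros; apply Hb).
  simpl in HK |- *. apply Rabs_def2 in HK; apply Rabs_def2 in HN0.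
  apply Rabs_def1; lra.
Qed.

(** Coefficientwise convergence from below, with multiplicative damping [t]. The limit coefficients
    themselves serve as majorant in [tannery], and multiplying by fixed weights, as differentiation
    does, leaves [t] unchanged. *)
Definition dominated_limit (d : nat -> nat -> R) (c : nat -> R) : Prop :=
  entire c /\ (forall k, 0 <= c k) /\
  exists t : nat -> nat -> R,
    (forall N k, 0 <= t N k <= 1) /\ (forall k, is_lim_seq (fun N => t N k) 1) /\
    (forall N k, d N k = t N k * c k).

Lemma dominated_limit_mul (m : nat -> R) d c :
  (forall k, 0 <= m k) -> entire (fun k => m k * c k) -> dominated_limit d c ->
  dominated_limit (fun N k => m k * d N k) (fun k => m k * c k).
Proof.
  intros Hm He [_ [Hc [t [Ht [Hl Hd]]]]]; split; [exact He|split].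
  - intros k; apply Rmult_le_pos; auto.
  - exists t; repeat split; try apply Ht; auto.
    intros N k; rewrite Hd; ring.
Qed.

Lemma dominated_limit_coef d c k :
  dominated_limit d c -> is_lim_seq (fun N => d N k) (c k).
Proof.
  intros [_ [_ [t [_ [Hl Hd]]]]].
  apply (is_lim_seq_ext (fun N => t N k * c k)); [intros; now rewrite Hd|].
  replace (Finite (c k)) with (Finite (1 * c k)) by (f_equal; ring).
  apply (is_lim_seq_scal_r _ _ (Finite 1)), Hl.
Qed.

Lemma dominated_limit_entire d c N : dominated_limit d c -> entire (d N).
Proof.
  intros [He [Hc [t [Ht [_ Hd]]]]]; apply (entire_le c); [|exact He].
  intros k; rewrite Hd, Rabs_mult; specialize (Ht N k).
  rewrite (Rabs_pos_eq (t N k)) by lra.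
  pose proof (Rabs_pos (c k)); nra.
Qed.

Lemma dominated_limit_uniform d c rho : dominated_limit d c -> 0 <= rho ->
  exists tau : nat -> R, is_lim_seq tau 0 /\
    forall N w, Cmod w <= rho -> Cmod (Ceval (d N) w - Ceval c w)%C <= tau N.
Proof.
  intros H Hrho; pose proof (fun N => dominated_limit_entire d c N H) as Hde.
  destruct H as [He [Hc [t [Ht [Hl Hd]]]]].
  assert (Hex : ex_series (fun k => c k * rho ^ k)).
  { eapply ex_series_ext; [|apply (He rho)].
    intros k; apply Rabs_pos_eq, Rmult_le_pos; auto using pow_le. }
  exists (fun N => Series (fun k => (1 - t N k) * (c k * rho ^ k))); split.
  - apply tannery; auto.
    + intros k; apply Rmult_le_pos; auto using pow_le.
    + intros N k; specialize (Ht N k); lra.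
    + intros k; replace 0 with (1 - 1) by ring; apply is_lim_seq_minus'; auto.
      apply is_lim_seq_const.
  - intros N w Hw.
    replace (Ceval (d N) w - Ceval c w)%C with (Ceval (fun k => d N k + (-1) * c k) w).
    2: { rewrite Ceval_plus, Ceval_scal by auto using entire_scal. ring. }
    eapply Rle_trans; [apply Ceval_norm; auto using entire_plus, entire_scal|].
    apply Series_le.
    + intros k; split; [apply Rmult_le_pos; [apply Rabs_pos|apply pow_le, Cmod_ge_0]|].
      rewrite Hd. replace (t N k * c k + -1 * c k) with (- ((1 - t N k) * c k)) by ring.
      specialize (Ht N k); specialize (Hc k).
      rewrite Rabs_Ropp, Rabs_pos_eq by (apply Rmult_le_pos; lra).
      rewrite <- Rmult_assoc; apply Rmult_le_compat_l; [apply Rmult_le_pos; lra|].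
      apply pow_incr; split; [apply Cmod_ge_0|exact Hw].
    + apply (ex_series_Rabs_le _ (fun k => c k * rho ^ k)); [|exact Hex].
      intros k; specialize (Ht N k); assert (0 <= c k * rho ^ k).
      { apply Rmult_le_pos; auto using pow_le. }
      rewrite Rabs_pos_eq by (apply Rmult_le_pos; lra). nra.
Qed.

Lemma dominated_limit_PSeries d c x : dominated_limit d c ->
  is_lim_seq (fun N => PSeries (d N) x) (PSeries c x).
Proof.
  intros H; destruct (dominated_limit_uniform d c (Rabs x) H (Rabs_pos x)) as [tau [T1 T2]].
  apply is_lim_seq_spec in T1; apply is_lim_seq_spec; intros eps.
  destruct (T1 eps) as [N0 HN0]; exists N0; intros N HN.
  specialize (HN0 N HN); rewrite Rminus_0_r in HN0; apply Rabs_def2 in HN0.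
  specialize (T2 N (RtoC x)); rewrite !Ceval_RtoC, <- RtoC_minus, !Cmod_R in T2.
  specialize (T2 (Rle_refl _)); lra.
Qed.

Lemma dominated_limit_Cmod d c w : dominated_limit d c ->
  is_lim_seq (fun N => Cmod (Ceval (d N) w)) (Cmod (Ceval c w)).
Proof.
  intros H; destruct (dominated_limit_uniform d c (Cmod w) H (Cmod_ge_0 w)) as [tau [T1 T2]].
  apply is_lim_seq_spec in T1; apply is_lim_seq_spec; intros eps.
  destruct (T1 eps) as [N0 HN0]; exists N0; intros N HN.
  specialize (HN0 N HN); rewrite Rminus_0_r in HN0; apply Rabs_def2 in HN0.
  specialize (T2 N w (Rle_refl _)).
  set (x := Ceval (d N) w) in *; set (y := Ceval c w) in *.
  pose proof (Cmod_triangle (x - y)%C y) as K1.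
  replace (x - y + y)%C with x in K1 by ring.
  pose proof (Cmod_triangle (- (x - y))%C x) as K2; rewrite Cmod_opp in K2.
  replace (- (x - y) + x)%C with y in K2 by ring.
  apply Rabs_def1; lra.
Qed.

Lemma PSeries_entire_continuous c x : entire c -> continuity_pt (PSeries c) x.
Proof. intros H; now apply PSeries_continuity, entire_CV_radius. Qed.

Lemma PSeries_opp_continuous c x : entire c -> continuity_pt (fun y => PSeries c (- y)) x.
Proof.
  intros H; apply (continuity_pt_comp Ropp (PSeries c)).
  - apply continuity_pt_opp, continuity_pt_id.
  - now apply PSeries_entire_continuous.
Qed.

Lemma rprod_root s p : In p s -> 0 < p -> rprod s (- / p) = 0.
Proof.
  intros H Hp; rewrite rprod_opp; induction s as [|a s IH]; [easy|].
  destruct H as [->|H]; simpl; [|rewrite IH by exact H; ring].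
  rewrite Rinv_r by lra; ring.
Qed.

(** * Zeros and power sums of a limit of finite products *)

Section RealRootedLimit.
Variables (c : nat -> R) (s : nat -> list R).
Hypothesis c_lim : dominated_limit (fun N => elsym (s N)) c.
Hypothesis s_pos : forall N, Forall (Rlt 0) (s N).

(** A real Hurwitz argument: the limit has a positive minimum on the interval, and an approximant
    closer to it than this minimum cannot vanish at [- / p] with [/ p <= r]. *)
Lemma roots_escape r : (forall x, 0 <= x <= r -> 0 < PSeries c (- x)) ->
  eventually (fun N => Forall (fun p => p * r < 1) (s N)).
Proof.
  intros Hpos; destruct (Rlt_or_le r 0) as [Hr|Hr].
  { exists O; intros N _; eapply Forall_impl; [|apply (s_pos N)]; simpl; intros; nra. }
  destruct (continuity_ab_min (fun y => PSeries c (- y)) 0 r Hr) as [m [Hm1 Hm2]].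
  { intros; apply PSeries_opp_continuous, c_lim. }
  pose proof (Hpos m Hm2) as Hm.
  destruct (dominated_limit_uniform _ c r c_lim Hr) as [tau [T1 T2]].
  apply is_lim_seq_spec in T1; destruct (T1 (mkposreal _ Hm)) as [N0 HN0].
  exists N0; intros N HN; specialize (HN0 N HN); simpl in HN0.
  rewrite Rminus_0_r in HN0; apply Rabs_def2 in HN0.
  pose proof (s_pos N) as Hs; rewrite Forall_forall in Hs |- *; intros p Hp.
  specialize (Hs p Hp); apply Rnot_le_lt; intros Hpr.
  assert (Hx : 0 < / p <= r).
  { split; [now apply Rinv_0_lt_compat|].
    apply Rmult_le_reg_l with p; [exact Hs|]; rewrite Rinv_r; lra. }
  specialize (T2 N (RtoC (- / p))); rewrite !Ceval_RtoC, PSeries_elsym, rprod_root in T2 by auto.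
  rewrite Cmod_R, Rabs_Ropp, Rabs_pos_eq in T2 by lra.
  specialize (T2 (proj2 Hx)); rewrite <- RtoC_minus, Cmod_R in T2.
  specialize (Hm1 (/ p)); specialize (Hpos (/ p)).
  rewrite Rminus_0_l, Rabs_Ropp, Rabs_pos_eq in T2; lra.
Qed.

(** The limit of [cprod_estimate]; the bound on the logarithmic derivative stays multiplied out, so
    that no division has to pass to the limit. *)
Lemma min_modulus r w : (forall x, 0 <= x <= r -> 0 < PSeries c (- x)) -> Cmod w <= r ->
  PSeries c (- r) <= Cmod (Ceval c w) /\
  Cmod (Ceval (fun k => INR k * c k) w) * PSeries c (- r)
    <= - PSeries (fun k => INR k * c k) (- r) * Cmod (Ceval c w).
Proof.
  intros Hpos Hw; pose proof (roots_escape r Hpos) as Hev.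
  assert (Hk : dominated_limit (fun N k => INR k * elsym (s N) k) (fun k => INR k * c k)).
  { apply dominated_limit_mul; auto using pos_INR; apply entire_INR, c_lim. }
  pose proof (dominated_limit_Cmod _ _ w c_lim) as L1.
  pose proof (dominated_limit_PSeries _ _ (- r) c_lim) as L2.
  pose proof (dominated_limit_Cmod _ _ w Hk) as L3.
  pose proof (dominated_limit_PSeries _ _ (- r) Hk) as L4.
  split.
  - refine (is_lim_seq_le_loc _ _ (Finite _) (Finite _) _ L2 L1).
    destruct Hev as [N0 H0]; exists N0; intros N HN.
    destruct (cprod_estimate (s N) r w (s_pos N) (H0 N HN) Hw) as [[_ K] _].
    cbv beta; now rewrite Ceval_elsym, PSeries_elsym.
  - refine (is_lim_seq_le_loc _ _ (Finite _) (Finite _) _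
              (is_lim_seq_mult' _ _ _ _ L3 L2)
              (is_lim_seq_mult' _ _ _ _ (proj1 (is_lim_seq_opp _ (Finite _)) L4) L1)).
    destruct Hev as [N0 H0]; exists N0; intros N HN.
    destruct (cprod_estimate (s N) r w (s_pos N) (H0 N HN) Hw) as [_ K].
    cbv beta; now rewrite Ceval_INR_elsym, PSeries_INR_elsym, Ceval_elsym, PSeries_elsym.
Qed.

Hypothesis c0 : c O = 1.
Hypothesis c_gt0 : forall k, 0 < c k.
(** The ratio of consecutive coefficients is [o(1/k)]. Hence terms with a factor growing like [k]
    become negligible against [c_1 c_(k+1)]. *)
Hypothesis c_decay : forall eps, 0 < eps ->
  exists K, forall k, (K <= k)%nat -> INR (S k) * c (S k) <= eps * c k.

Let S2 := c 1%nat ^ 2 - 2 * c 2%nat.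
Let S3 := c 1%nat ^ 3 - 3 * c 1%nat * c 2%nat + 3 * c 3%nat.

Let lim_c k : is_lim_seq (fun N => elsym (s N) k) (c k).
Proof. exact (dominated_limit_coef _ _ k c_lim). Qed.

Let lim_S1 : is_lim_seq (fun N => pow_sum 1 (s N)) (c 1%nat).
Proof.
  apply (is_lim_seq_ext (fun N => elsym (s N) 1)); [|apply lim_c].
  intros N; now rewrite pow_sum_1.
Qed.

Ltac lim := repeat match goal with
  | |- is_lim_seq (fun _ => ?a) _ => apply is_lim_seq_const
  | |- is_lim_seq (fun n => elsym (s n) _) _ => apply lim_c
  | |- is_lim_seq (fun n => pow_sum _ (s n)) _ => eassumption
  | |- is_lim_seq (fun n => _ - _) _ => apply is_lim_seq_minus'
  | |- is_lim_seq (fun n => _ + _) _ => apply is_lim_seq_plus'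
  | |- is_lim_seq (fun n => _ * _) _ => apply is_lim_seq_mult'
  end.

Let lim_S2 : is_lim_seq (fun N => pow_sum 2 (s N)) S2.
Proof.
  apply (is_lim_seq_ext (fun N => elsym (s N) 1 * (elsym (s N) 1 * 1) - 2 * elsym (s N) 2)).
  - intros N; now rewrite pow_sum_2.
  - unfold S2; simpl; lim.
Qed.

Let lim_S3 : is_lim_seq (fun N => pow_sum 3 (s N)) S3.
Proof.
  apply (is_lim_seq_ext (fun N => elsym (s N) 1 * (elsym (s N) 1 * (elsym (s N) 1 * 1))
     - 3 * elsym (s N) 1 * elsym (s N) 2 + 3 * elsym (s N) 3)).
  - intros N; now rewrite pow_sum_3.
  - unfold S3; simpl; lim.
Qed.

(** The limit of the finite power sums is only known to be nonnegative; [pow_sum_2_lower] at an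
    index where [c_decay] makes its left-hand side positive gives strictness. *)
Lemma S2_gt0 : 0 < S2.
Proof.
  pose proof (c_gt0 1) as H1.
  destruct (c_decay (c 1%nat / 2)) as [K HK]; [lra|].
  specialize (HK (S K) ltac:(lia)).
  assert (L : c 1%nat * c (S K) - INR (S (S K)) * c (S (S K)) <= S2 * c K).
  { refine (is_lim_seq_le _ _ (Finite _) (Finite _) (fun N => pow_sum_2_lower (s N) K (s_pos N)) _ _);
      lim. }
  pose proof (c_gt0 (S K)); pose proof (c_gt0 K).
  apply Rnot_le_lt; intros Hn. nra.
Qed.

(** The limit of [pow_sum_cauchy] reads [S2^2 <= S1 S3]. *)
Lemma S3_gt0 : 0 < S3.
Proof.
  pose proof S2_gt0 as H2; pose proof (c_gt0 1) as H1.
  assert (L : S2 * (S2 * 1) <= c 1%nat * S3).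
  { refine (is_lim_seq_le _ _ (Finite _) (Finite _) (fun N => pow_sum_cauchy (s N) (s_pos N)) _ _);
      simpl; lim. }
  apply Rnot_le_lt; intros Hn. nra.
Qed.

Let pos_upto (r : R) : Prop := forall x, 0 <= x <= r -> 0 < PSeries c (- x).

Lemma gap_limits r : pos_upto r ->
  r * S2 <= c 1%nat /\ r * S3 <= S2 /\
  (forall k, INR (S k) * c (S k) - r * (c 1%nat * c (S k) - INR (S (S k)) * c (S (S k)))
     <= (c 1%nat - r * S2) * c k) /\
  (forall k, c 1%nat * c (S k) - INR (S (S k)) * c (S (S k))
     - r * (S2 * c (S k) - c 1%nat * c (S (S k)) + INR (S (S (S k))) * c (S (S (S k))))
     <= (S2 - r * S3) * c k).
Proof.
  intros Hr; destruct (roots_escape r Hr) as [N0 H0].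
  repeat split; try intros k.
  - refine (is_lim_seq_le_loc _ _ (Finite _) (Finite _) (ex_intro _ N0 (fun N HN =>
      pow_sum_gap (s N) r 1 (s_pos N) (H0 N HN))) _ _); lim.
  - refine (is_lim_seq_le_loc _ _ (Finite _) (Finite _) (ex_intro _ N0 (fun N HN =>
      pow_sum_gap (s N) r 2 (s_pos N) (H0 N HN))) _ _); lim.
  - refine (is_lim_seq_le_loc _ _ (Finite _) (Finite _) (ex_intro _ N0 (fun N HN =>
      gap1_lower (s N) r k (s_pos N) (H0 N HN))) _ _); lim.
  - refine (is_lim_seq_le_loc _ _ (Finite _) (Finite _) (ex_intro _ N0 (fun N HN =>
      gap2_lower (s N) r k (s_pos N) (H0 N HN))) _ _); lim.
Qed.

(** The conditions on [r] are strict so that the approximants eventually satisfy them too. *)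
Lemma product_limits r : 0 <= r -> pos_upto r ->
  (c 1%nat * r < 1 ->
   1 - c 1%nat * r + ((c 1%nat * r) ^ 2 - S2 * r ^ 2) / 3 <= PSeries c (- r)) /\
  (S2 * r ^ 2 < 1 ->
   1 - S2 * r ^ 2 + ((S2 * r ^ 2) ^ 2 - S3 * r ^ 3) / 3 <= PSeries c (- r) * PSeries c r).
Proof.
  intros Hr0 Hr; pose proof (roots_escape r Hr) as Hev.
  pose proof (dominated_limit_PSeries _ _ (- r) c_lim) as L1.
  pose proof (dominated_limit_PSeries _ _ r c_lim) as L2.
  split; intros Hlt.
  - assert (Ev : eventually (fun N => pow_sum 1 (s N) * r < 1)).
    { assert (L : is_lim_seq (fun N => pow_sum 1 (s N) * r) (c 1%nat * r)) by lim.
      apply is_lim_seq_spec in L; destruct (L (mkposreal (1 - c 1%nat * r) ltac:(lra))) as [N0 H0].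
      exists N0; intros N HN; specialize (H0 N HN); simpl in H0; apply Rabs_def2 in H0; lra. }
    refine (is_lim_seq_le_loc (fun N => 1 - pow_sum 1 (s N) * r
      + ((pow_sum 1 (s N) * r) ^ 2 - pow_sum 2 (s N) * r ^ 2) / 3) _ (Finite _) (Finite _) _ _ L1).
    + destruct Hev as [N0 H0], Ev as [N1 H1]; exists (Nat.max N0 N1); intros N HN.
      rewrite PSeries_elsym.
      apply (rprod_lower1 (s N) r (s_pos N) (H0 N ltac:(lia)) Hr0).
      specialize (H1 N ltac:(lia)); lra.
    + simpl; unfold Rdiv; lim.
  - assert (Ev : eventually (fun N => pow_sum 2 (s N) * (r * (r * 1)) < 1)).
    { assert (L : is_lim_seq (fun N => pow_sum 2 (s N) * (r * (r * 1))) (S2 * (r * (r * 1)))) by lim.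
      simpl in Hlt.
      apply is_lim_seq_spec in L.
      destruct (L (mkposreal (1 - S2 * (r * (r * 1))) ltac:(lra))) as [N0 H0].
      exists N0; intros N HN; specialize (H0 N HN); simpl in H0; apply Rabs_def2 in H0; lra. }
    refine (is_lim_seq_le_loc (fun N => 1 - pow_sum 2 (s N) * r ^ 2
      + ((pow_sum 2 (s N) * r ^ 2) ^ 2 - pow_sum 3 (s N) * r ^ 3) / 3) _ (Finite _) (Finite _)
      _ _ (is_lim_seq_mult' _ _ _ _ L1 L2)).
    + destruct Hev as [N0 H0], Ev as [N1 H1]; exists (Nat.max N0 N1); intros N HN.
      rewrite !PSeries_elsym.
      apply (rprod_lower2 (s N) r (s_pos N) (H0 N ltac:(lia)) Hr0).
      specialize (H1 N ltac:(lia)); simpl; lra.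
    + simpl; unfold Rdiv; lim.
Qed.

(** Transfers to the zero [w] the inequalities available for [r < w]; at [w] itself [roots_escape]
    does not apply. *)
Lemma continuous_ge0_left (f : R -> R) w :
  0 < w -> continuity_pt f w -> (forall r, 0 <= r < w -> 0 <= f r) -> 0 <= f w.
Proof.
  intros Hw Hc Hf; apply Rnot_lt_le; intros Hn.
  destruct (Hc (- f w) ltac:(lra)) as [d [Hd H]].
  set (y := Rmax 0 (w - d / 2)).
  assert (Hy : 0 <= y < w) by (unfold y; split; [apply Rmax_l|apply Rmax_lub_lt; lra]).
  assert (Hy' : w - d / 2 <= y) by apply Rmax_r.
  specialize (H y); simpl in H; unfold Rdist in H.
  specialize (Hf y Hy).
  assert (K : Rabs (f y - f w) < - f w).
  { apply H; split; [split; [exact I|lra]|]. apply Rabs_def1; lra. }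
  apply Rabs_def2 in K; lra.
Qed.

(** [w] is the supremum of the radii up to which the limit is positive. That this supremum is
    finite, hence that a zero exists, comes from [r S2 <= S1] with [S2 > 0]. *)
Lemma first_zero :
  exists w, 0 < w /\ PSeries c (- w) = 0 /\ (forall x, 0 <= x < w -> 0 < PSeries c (- x)).
Proof.
  assert (Hcont : forall x, continuity_pt (fun y => PSeries c (- y)) x).
  { intros; apply PSeries_opp_continuous, c_lim. }
  assert (H0 : PSeries c (- 0) = 1) by (now rewrite Ropp_0, PSeries_0).
  pose proof S2_gt0 as HS2.
  destruct (completeness (fun r => 0 <= r /\ pos_upto r)) as [w [Hub Hlub]].
  { exists (c 1%nat / S2); intros r [_ Hr]; destruct (gap_limits r Hr) as [H _].
    apply Rmult_le_reg_r with S2; [exact HS2|]; unfold Rdiv.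
    rewrite Rmult_assoc, Rinv_l; lra. }
  { exists 0; split; [lra|]; intros x Hx; replace x with 0 by lra; lra. }
  assert (Hext : forall r, 0 <= r -> pos_upto r -> exists d, 0 < d /\ pos_upto (r + d)).
  { intros r Hr Hp; pose proof (Hp r ltac:(lra)) as Hg.
    destruct (Hcont r (PSeries c (- r)) Hg) as [d [Hd H]].
    exists (d / 2); split; [lra|]; intros x Hx.
    destruct (Rle_or_lt x r) as [Hxr|Hxr]; [apply Hp; lra|].
    specialize (H x); simpl in H; unfold Rdist in H.
    assert (K : Rabs (PSeries c (- x) - PSeries c (- r)) < PSeries c (- r)).
    { apply H; split; [split; [exact I|lra]|]. apply Rabs_def1; lra. }
    apply Rabs_def2 in K; lra. }
  assert (Hw : 0 < w).
  { destruct (Hext 0 (Rle_refl 0)) as [d [Hd Hp]].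
    - intros x Hx; replace x with 0 by lra; lra.
    - apply Rlt_le_trans with (1 := Hd), Hub; split; [lra|].
      now rewrite Rplus_0_l in Hp. }
  assert (Hbelow : forall x, 0 <= x < w -> 0 < PSeries c (- x)).
  { intros x Hx; apply Rnot_le_lt; intros Hn.
    apply (Rlt_not_le w x); [lra|]; apply Hlub; intros r [Hr Hp].
    apply Rnot_lt_le; intros Hxr; specialize (Hp x); lra. }
  exists w; split; [exact Hw|split; [|exact Hbelow]].
  assert (Hge : 0 <= PSeries c (- w)).
  { apply (continuous_ge0_left (fun y => PSeries c (- y))); auto.
    intros r Hr; left; auto. }
  destruct Hge as [Hgt|]; [exfalso|auto].
  destruct (Hext w) as [d [Hd Hp]]; [lra| |].
  - intros x Hx; destruct (Req_dec x w) as [->|]; [exact Hgt|apply Hbelow; lra].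
  - specialize (Hub (w + d)); assert (w + d <= w); [apply Hub; split; [lra|exact Hp]|lra].
Qed.

(* Euler-Rayleigh inequalities for the power sums [S_m] of the reciprocal zeros.
   Strictness comes from weighting the gap [S_m - w S_{m+1}] by elementary symmetric
   polynomials of large degree, see [gap1_lower] and [gap2_lower]. *)
Lemma euler_rayleigh w : 0 < w -> PSeries c (- w) = 0 ->
  (forall x, 0 <= x < w -> 0 < PSeries c (- x)) ->
  w * S2 < c 1%nat /\ w * S3 < S2 /\ 1 < c 1%nat * w /\ 1 < S2 * w ^ 2.
Proof.
  intros Hw Hz Hbelow.
  assert (Hup : forall r, 0 <= r < w -> pos_upto r).
  { intros r Hr x Hx; apply Hbelow; lra. }
  pose proof S2_gt0 as HS2; pose proof S3_gt0 as HS3; pose proof (c_gt0 1) as HS1.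
  assert (G1 : forall k, 0 <= (c 1%nat - w * S2) * c k -
     (INR (S k) * c (S k) - w * (c 1%nat * c (S k) - INR (S (S k)) * c (S (S k))))).
  { intros k; apply (continuous_ge0_left (fun r => (c 1%nat - r * S2) * c k -
     (INR (S k) * c (S k) - r * (c 1%nat * c (S k) - INR (S (S k)) * c (S (S k)))))); auto.
    - reg.
    - intros r Hr; destruct (gap_limits r (Hup r Hr)) as [_ [_ [K _]]]; specialize (K k); lra. }
  assert (G2 : forall k, 0 <= (S2 - w * S3) * c k - (c 1%nat * c (S k) - INR (S (S k)) * c (S (S k))
     - w * (S2 * c (S k) - c 1%nat * c (S (S k)) + INR (S (S (S k))) * c (S (S (S k)))))).
  { intros k; apply (continuous_ge0_left (fun r => (S2 - r * S3) * c k -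
     (c 1%nat * c (S k) - INR (S (S k)) * c (S (S k))
     - r * (S2 * c (S k) - c 1%nat * c (S (S k)) + INR (S (S (S k))) * c (S (S (S k)))))));
      auto.
    - reg.
    - intros r Hr; destruct (gap_limits r (Hup r Hr)) as [_ [_ [_ K]]]; specialize (K k); lra. }
  assert (D1 : w * S2 < c 1%nat).
  { destruct (INR_unbounded (w * c 1%nat)) as [k Hk].
    specialize (G1 k); pose proof (c_gt0 k); pose proof (c_gt0 (S k)); pose proof (c_gt0 (S (S k))).
    assert (0 < w * (INR (S (S k)) * c (S (S k)))).
    { repeat apply Rmult_lt_0_compat; auto; apply lt_0_INR; lia. }
    assert (0 < (INR (S k) - w * c 1%nat) * c (S k)).
    { apply Rmult_lt_0_compat; auto; rewrite S_INR; lra. }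
    apply Rnot_le_lt; intros Hn. nra. }
  assert (D2 : w * S3 < S2).
  { set (eps := Rmin 1 ((c 1%nat - w * S2) / (2 * (1 + w)))).
    assert (He : 0 < eps).
    { unfold eps; apply Rmin_glb_lt; [lra|]; apply Rdiv_lt_0_compat; lra. }
    destruct (c_decay eps He) as [k Hk].
    pose proof (Hk (S k) ltac:(lia)) as K1; pose proof (Hk (S (S k)) ltac:(lia)) as K2.
    specialize (G2 k); pose proof (c_gt0 k) as P0; pose proof (c_gt0 (S k)) as P1.
    pose proof (c_gt0 (S (S k))) as P2.
    assert (K3 : c (S (S k)) <= INR (S (S k)) * c (S (S k))).
    { rewrite <- (Rmult_1_l (c (S (S k)))) at 1; apply Rmult_le_compat_r; [lra|].
      rewrite S_INR; pose proof (pos_INR (S k)); lra. }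
    assert (E1 : eps <= 1) by apply Rmin_l.
    assert (E2 : eps * (2 * (1 + w)) <= c 1%nat - w * S2).
    { apply Rmult_le_reg_r with (/ (2 * (1 + w))); [apply Rinv_0_lt_compat; lra|].
      rewrite Rmult_assoc, Rinv_r, Rmult_1_r by lra; apply Rmin_r. }
    set (x := INR (S (S k)) * c (S (S k))) in *.
    set (y := INR (S (S (S k))) * c (S (S (S k)))) in *.
    assert (Y : y <= eps * c (S k)) by nra.
    assert (w * y <= w * (eps * c (S k))) by (apply Rmult_le_compat_l; lra).
    assert (0 < w * (c 1%nat * c (S (S k)))) by (repeat apply Rmult_lt_0_compat; auto).
    assert (eps * (2 * (1 + w)) * c (S k) <= (c 1%nat - w * S2) * c (S k))
      by (apply Rmult_le_compat_r; lra).
    assert (0 < eps * c (S k)) by (apply Rmult_lt_0_compat; auto).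
    assert (0 < w * (eps * c (S k))) by (apply Rmult_lt_0_compat; auto).
    apply Rnot_le_lt; intros Hn. nra. }
  split; [exact D1|split; [exact D2|split]].
  (* Put [a = S1 w]. By [D1], [S2 w^2 < a]; if [a <= 1], the product bound at [w] exceeds [1 - a +
     (a^2 - a)/3 = (1 - a)(1 - a/3) >= 0], although the function vanishes there. *)
  - apply Rnot_le_lt; intros Hn.
    assert (K : 0 <= PSeries c (- w) - (1 - c 1%nat * w + ((c 1%nat * w) ^ 2 - S2 * w ^ 2) / 3)).
    { apply (continuous_ge0_left (fun r => PSeries c (- r) -
        (1 - c 1%nat * r + ((c 1%nat * r) ^ 2 - S2 * r ^ 2) / 3))); auto.
      - apply continuity_pt_minus; [apply PSeries_opp_continuous, c_lim|reg].
      - intros r Hr; destruct (product_limits r ltac:(lra) (Hup r Hr)) as [K _].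
        assert (c 1%nat * r < c 1%nat * w) by (apply Rmult_lt_compat_l; lra).
        specialize (K ltac:(lra)); lra. }
    rewrite Hz in K.
    assert (0 < w * (c 1%nat - w * S2)) by (apply Rmult_lt_0_compat; lra).
    assert (0 < c 1%nat * w) by (apply Rmult_lt_0_compat; lra).
    nra.
  (* The same computation with [a = S2 w^2] and [S3 w^3 < a], which is [D2]. *)
  - apply Rnot_le_lt; intros Hn.
    assert (K : 0 <= PSeries c (- w) * PSeries c w
       - (1 - S2 * w ^ 2 + ((S2 * w ^ 2) ^ 2 - S3 * w ^ 3) / 3)).
    { apply (continuous_ge0_left (fun r => PSeries c (- r) * PSeries c r -
        (1 - S2 * r ^ 2 + ((S2 * r ^ 2) ^ 2 - S3 * r ^ 3) / 3))); auto.
      - apply continuity_pt_minus; [|reg].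
        apply continuity_pt_mult;
          [apply PSeries_opp_continuous, c_lim|apply PSeries_entire_continuous, c_lim].
      - intros r Hr; destruct (product_limits r ltac:(lra) (Hup r Hr)) as [_ K].
        assert (S2 * r ^ 2 < S2 * w ^ 2) by (apply Rmult_lt_compat_l; nra).
        specialize (K ltac:(lra)); lra. }
    rewrite Hz in K.
    assert (P1 : 0 < w ^ 2 * (S2 - w * S3)) by (apply Rmult_lt_0_compat; nra).
    replace (w ^ 2 * (S2 - w * S3)) with (S2 * w ^ 2 - S3 * w ^ 3) in P1 by ring.
    assert (P2 : 0 < S2 * w ^ 2) by (apply Rmult_lt_0_compat; nra).
    revert K P1 P2 Hn; generalize (S2 * w ^ 2), (S3 * w ^ 3); intros; nra.
Qed.

End RealRootedLimit.

(** * Complex differentiability *)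

(** A quadratic remainder with an explicit constant allows termwise differentiation: the remainders
    of the terms are simply summed. *)
Lemma is_derive_C_of_quadratic (f : C -> C) (z l : C) (M : R) :
  (forall h, Cmod h <= 1 -> Cmod (f (z + h) - f z - h * l)%C <= M * Cmod h ^ 2) ->
  is_derive (K := C_AbsRing) (V := C_NormedModule) f z l.
Proof.
  intros H; split; [apply is_linear_scal_l|].
  intros x Hx; rewrite <- (is_filter_lim_locally_unique _ _ Hx); intros eps.
  assert (HM : 0 <= M).
  { specialize (H 1%C); rewrite Cmod_1 in H; specialize (H (Rle_refl _)).
    eapply Rle_trans; [apply Cmod_ge_0|]; eapply Rle_trans; [exact H|lra]. }
  assert (Hd : 0 < Rmin 1 (eps / (M + 1))).
  { apply Rmin_glb_lt; [lra|]; apply Rdiv_lt_0_compat; [apply cond_pos|lra]. }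
  assert (K : forall y : C, Cmod (y - z)%C < Rmin 1 (eps / (M + 1)) ->
    Cmod (f y - f z - (y - z) * l)%C <= eps * Cmod (y - z)%C).
  2: exact (ex_intro _ (mkposreal _ Hd) K).
  intros y Hy.
  specialize (H (y - z)%C).
  replace (z + (y - z))%C with y in H by ring.
  assert (H1 : Cmod (y - z)%C <= 1) by (left; eapply Rlt_le_trans; [exact Hy|apply Rmin_l]).
  assert (H2 : Cmod (y - z)%C * (M + 1) <= eps).
  { left; apply Rmult_lt_reg_r with (/ (M + 1)); [apply Rinv_0_lt_compat; lra|].
    rewrite Rmult_assoc, Rinv_r, Rmult_1_r by lra.
    eapply Rlt_le_trans; [exact Hy|apply Rmin_r]. }
  eapply Rle_trans; [apply H, H1|].
  pose proof (Cmod_ge_0 (y - z)%C); nra.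
Qed.

(** Crude but sufficient: [m^2 rho^m] is still summable against the coefficients of an entire
    function. *)
Lemma Cpow_taylor (z h : C) (rho : R) (m : nat) : 1 <= rho -> Cmod z + Cmod h <= rho ->
  Cmod ((z + h) ^ m - z ^ m - RtoC (INR m) * h * z ^ pred m)%C
    <= INR m ^ 2 * Cmod h ^ 2 * rho ^ m.
Proof.
  intros H1 H2; pose proof (Cmod_ge_0 z) as Hz; pose proof (Cmod_ge_0 h) as Hh.
  induction m as [|m IH].
  { simpl; replace (1 - 1 - 0 * h * 1)%C with (RtoC 0) by ring; rewrite Cmod_0; lra. }
  set (d := ((z + h) ^ m - z ^ m - RtoC (INR m) * h * z ^ pred m)%C) in *.
  replace ((z + h) ^ S m - z ^ S m - RtoC (INR (S m)) * h * z ^ pred (S m))%C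
    with ((z + h) * d + RtoC (INR m) * (h * h * z ^ pred m))%C.
  2: { unfold d; rewrite !Cpow_S, S_INR, RtoC_plus; destruct m as [|m]; simpl pred.
       - simpl INR; simpl; ring.
       - rewrite !Cpow_S; ring. }
  eapply Rle_trans; [apply Cmod_triangle|]; rewrite !Cmod_mult, Cmod_pow.
  rewrite Cmod_RtoC_pos by apply pos_INR.
  assert (K1 : Cmod (z + h)%C * Cmod d <= rho * (INR m ^ 2 * Cmod h ^ 2 * rho ^ m)).
  { apply Rmult_le_compat; try apply Cmod_ge_0; auto.
    eapply Rle_trans; [apply Cmod_triangle|exact H2]. }
  assert (K2 : Cmod z ^ pred m <= rho ^ S m).
  { apply Rle_trans with (rho ^ pred m); [apply pow_incr; lra|apply Rle_pow; [exact H1|lia]]. }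
  pose proof (pos_INR m) as Hm.
  assert (K3 : INR m * (Cmod h * Cmod h * Cmod z ^ pred m) <= INR m * (Cmod h * Cmod h * rho ^ S m)).
  { apply Rmult_le_compat_l; [exact Hm|]; apply Rmult_le_compat_l; [nra|exact K2]. }
  assert (K4 : 0 <= Cmod h ^ 2 * rho ^ S m).
  { apply Rmult_le_pos; [nra|apply pow_le; lra]. }
  rewrite S_INR; simpl pow in *; nra.
Qed.

Lemma entire_odd c : entire c -> entire (fun k => INR (2 * k + 1) * c k).
Proof.
  intros H; apply (entire_le (fun k => 2 * (INR k * c k) + c k)).
  - intros k; right; f_equal; rewrite plus_INR, mult_INR; simpl; ring.
  - apply entire_plus, H; apply entire_scal, entire_INR, H.
Qed.

Lemma Ceval_odd c w : entire c ->
  Ceval (fun k => INR (2 * k + 1) * c k) w = (Ceval c w + RtoC 2 * Ceval (fun k => (INR k * c k)%R) w)%C.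
Proof.
  intros H; rewrite (Ceval_ext _ (fun k => c k + 2 * (INR k * c k))).
  - rewrite Ceval_plus, Ceval_scal; auto using entire_INR, entire_scal.
  - intros k; rewrite plus_INR, mult_INR; simpl; ring.
Qed.

Lemma RtoC_m1 : RtoC (-1) = (- (1))%C.
Proof. apply injective_projections; simpl; ring. Qed.

Lemma Cpow_neg_sq (z : C) n : (RtoC ((-1) ^ n)%R * z ^ (2 * n + 1))%C = (z * (- (z * z)) ^ n)%C.
Proof.
  induction n as [|n IH]; [simpl; ring|].
  replace (2 * S n + 1)%nat with (S (S (2 * n + 1))) by lia.
  rewrite !Cpow_S.
  replace (z * (- (z * z) * (- (z * z)) ^ n))%C with (- (z * z) * (z * (- (z * z)) ^ n))%C by ring.
  rewrite <- IH; simpl pow; rewrite RtoC_mult, RtoC_m1; ring.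
Qed.

(** * Odd power series and their complex derivative *)

Section OddSeries.
Variable c : nat -> R.
Hypothesis c_entire : entire c.

Let term (z : C) (n : nat) : C := (RtoC ((-1) ^ n * c n)%R * z ^ (2 * n + 1))%C.

Let term_eq z n : term z n = (z * (RtoC (c n) * (- (z * z)) ^ n))%C.
Proof.
  unfold term; rewrite RtoC_mult.
  replace (z * (RtoC (c n) * (- (z * z)) ^ n))%C
    with (RtoC (c n) * (z * (- (z * z)) ^ n))%C by ring.
  rewrite <- Cpow_neg_sq; ring.
Qed.

Let term_summable z : abs_summable (term z).
Proof.
  eapply ex_series_ext; [intros n; rewrite term_eq; reflexivity|].
  apply (abs_summable_scal z), entire_abs_summable, c_entire.
Qed.

Lemma odd_series_eq z : CSum (term z) = (z * Ceval c (- (z * z)))%C.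
Proof.
  unfold Ceval; rewrite <- CSum_scal by now apply entire_abs_summable.
  apply CSum_ext, term_eq.
Qed.

Lemma odd_series_derive z : is_derive (K := C_AbsRing) (V := C_NormedModule)
  (fun y => CSum (term y)) z (Ceval (fun k => INR (2 * k + 1) * c k) (- (z * z))).
Proof.
  set (rho := Cmod z + 1); pose proof (Cmod_ge_0 z) as Hz.
  (* Majorant of the remainders from [Cpow_taylor]: [|h| <= 1] gives [|z| + |h| <= rho]. *)
  set (b := fun n => Rabs (c n) * (INR (2 * n + 1) ^ 2 * rho ^ (2 * n + 1))).
  assert (Hb : ex_series b).
  { apply (ex_series_ext (fun n => rho * Rabs (INR (2 * n + 1) * (INR (2 * n + 1) * c n) * (rho ^ 2) ^ n))).
    - intros n; unfold b; rewrite !Rabs_mult, <- pow_mult, (Rabs_pos_eq (INR _)) by apply pos_INR.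
      rewrite (Rabs_pos_eq (rho ^ _)) by (apply pow_le; unfold rho; lra).
      rewrite (pow_add rho (2 * n) 1).
      match goal with |- ?x = ?y => change (@eq R x y) end; ring.
    - apply (ex_series_scal (V := R_NormedModule)), (entire_odd _ (entire_odd _ c_entire)). }
  apply (is_derive_C_of_quadratic _ _ _ (Series b)); intros h Hh.
  set (lin := fun n => (RtoC (- (1)) * (h * (RtoC (INR (2 * n + 1) * c n)%R * (- (z * z)) ^ n)))%C).
  assert (Hlin : abs_summable lin).
  { apply (abs_summable_scal (RtoC (- (1)))), (abs_summable_scal h), entire_abs_summable.
    apply entire_odd, c_entire. }
  replace (CSum (term (z + h)) - CSum (term z)
    - h * Ceval (fun k => (INR (2 * k + 1) * c k)%R) (- (z * z)))%C
    with (CSum (fun n => term (z + h) n + (RtoC (- (1)) * term z n + lin n))%C).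
  2: { rewrite !CSum_plus, CSum_scal; auto using abs_summable_plus, abs_summable_scal.
       unfold lin; rewrite CSum_scal, CSum_scal; auto using abs_summable_scal, entire_abs_summable, entire_odd.
       unfold Ceval; rewrite RtoC_opp; ring. }
  assert (Hn : forall n, Cmod (term (z + h) n + (RtoC (- (1)) * term z n + lin n))%C <= b n * Cmod h ^ 2).
  { intros n.
    replace (term (z + h) n + (RtoC (- (1)) * term z n + lin n))%C
      with (RtoC ((-1) ^ n * c n)%R * ((z + h) ^ (2 * n + 1) - z ^ (2 * n + 1)
        - RtoC (INR (2 * n + 1)) * h * z ^ pred (2 * n + 1)))%C.
    - rewrite Cmod_mult, Cmod_R, Rabs_mult, pow_1_abs, Rmult_1_l.
      unfold b; rewrite !Rmult_assoc; apply Rmult_le_compat_l; [apply Rabs_pos|].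
      eapply Rle_trans; [apply (Cpow_taylor z h rho); unfold rho; lra|right; ring].
    - unfold term, lin; rewrite !RtoC_opp.
      replace (pred (2 * n + 1)) with (2 * n)%nat by lia.
      replace ((- (z * z)) ^ n)%C with (RtoC ((-1) ^ n)%R * z ^ (2 * n))%C.
      + rewrite !RtoC_mult; ring.
      + rewrite Cpow_mult_r; replace (- (z * z))%C with (RtoC (-1) * (z ^ 2))%C.
        * now rewrite Cpow_mult_l, RtoC_pow.
        * rewrite RtoC_m1; simpl; ring. }
  eapply Rle_trans; [apply CSum_norm|].
  - apply abs_summable_plus; auto; apply abs_summable_plus; auto using abs_summable_scal.
  - rewrite <- Series_scal_r; apply Series_le.
    + intros n; split; [apply Cmod_ge_0|apply Hn].
    + apply (ex_series_scal_r (Cmod h ^ 2)), Hb.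
Qed.

End OddSeries.

(** * Bounds for q-shifted factorials *)

Lemma qpoch_lower a q n : 0 < a < 1 -> 0 < q < 1 ->
  exp (- (a / (1 - a) * ((1 - q ^ n) / (1 - q)))) <= qpoch a q n.
Proof.
  intros Ha Hq; induction n as [|n IH]; simpl qpoch.
  - simpl; replace (- _) with 0 by (field; lra); rewrite exp_0; lra.
  - set (x := a * q ^ n).
    assert (Hx : 0 < x <= a).
    { pose proof (pow_lt q n (proj1 Hq)).
      assert (q ^ n <= 1) by (rewrite <- (pow1 n); apply pow_incr; lra).
      unfold x; split; [apply Rmult_lt_0_compat; lra|nra]. }
    (* For [0 < x <= a], [(1 - x)(1 + x/(1 - a)) >= 1]. With [x = a q^n] the exponents add up to the
       geometric sum in the statement. *)
    assert (K : exp (- (x / (1 - a))) <= 1 - x).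
    { rewrite exp_Ropp; pose proof (exp_ineq1_le (x / (1 - a))) as E.
      apply Rmult_le_reg_r with (exp (x / (1 - a))); [apply exp_pos|].
      rewrite Rinv_l by (pose proof (exp_pos (x / (1 - a))); lra).
      apply Rle_trans with ((1 - x) * (1 + x / (1 - a))); [|apply Rmult_le_compat_l; lra].
      replace ((1 - x) * (1 + x / (1 - a))) with (1 + x * (a - x) / (1 - a)) by (field; lra).
      assert (0 <= x * (a - x) / (1 - a)) by (apply Rdiv_le_0_compat; nra). lra. }
    replace (- _) with (- (a / (1 - a) * ((1 - q ^ n) / (1 - q))) + - (x / (1 - a))).
    + rewrite exp_plus; apply Rmult_le_compat; try (left; apply exp_pos); assumption.
    + unfold x; simpl; field; lra.
Qed.

Lemma qpoch_pos a q n : 0 < a < 1 -> 0 < q < 1 -> 0 < qpoch a q n.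
Proof. intros Ha Hq; eapply Rlt_le_trans; [apply exp_pos|apply qpoch_lower; assumption]. Qed.

(** A decreasing sequence with a positive lower bound. This makes [real (Lim_seq _)] a genuine limit
    and the constant in front of [J2] nonzero. *)
Lemma qpoch_inf_pos a q : 0 < a < 1 -> 0 < q < 1 -> 0 < qpoch_inf a q.
Proof.
  intros Ha Hq; set (L := exp (- (a / (1 - a) * (1 / (1 - q))))).
  assert (HL : forall n, L <= qpoch a q n).
  { intros n; eapply Rle_trans; [|apply qpoch_lower; assumption]; unfold L.
    left; apply exp_increasing, Ropp_lt_contravar, Rmult_lt_compat_l;
      [apply Rdiv_lt_0_compat; lra|].
    apply Rmult_lt_compat_r; [apply Rinv_0_lt_compat; lra|].
    pose proof (pow_lt q n (proj1 Hq)); lra. }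
  assert (Hex : ex_finite_lim_seq (qpoch a q)).
  { apply (ex_finite_lim_seq_decr _ L); [|exact HL]; intros n; simpl.
    pose proof (qpoch_pos a q n Ha Hq); pose proof (pow_lt q n (proj1 Hq)).
    assert (0 < qpoch a q n * (a * q ^ n)) by (repeat apply Rmult_lt_0_compat; lra). lra. }
  destruct Hex as [l Hl]; change (0 < real (Lim_seq (qpoch a q))); rewrite (is_lim_seq_unique _ _ Hl); simpl.
  apply Rlt_le_trans with L; [apply exp_pos|].
  exact (is_lim_seq_le _ _ (Finite L) (Finite l) HL (is_lim_seq_const L) Hl).
Qed.

(** [(k + 1) q^k] is at most [1 + q + ... + q^k = (1 - q^(k+1)) / (1 - q)]. *)
Lemma INR_pow_le q k : 0 < q < 1 -> INR (S k) * q ^ k * (1 - q) <= 1.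
Proof.
  intros Hq; apply Rle_trans with (1 - q ^ S k).
  2: { pose proof (pow_lt q (S k) (proj1 Hq)); lra. }
  induction k as [|k IH]; [simpl; lra|].
  pose proof (pow_lt q k (proj1 Hq)).
  assert (q ^ k <= 1) by (rewrite <- (pow1 k); apply pow_incr; lra).
  rewrite S_INR; simpl pow in *.
  set (A := INR (S k) * q ^ k * (1 - q)) in *.
  replace ((INR (S k) + 1) * (q * q ^ k) * (1 - q)) with (q * A + q * q ^ k * (1 - q))
    by (unfold A; ring).
  assert (q * A <= q * (1 - q * q ^ k)) by (apply Rmult_le_compat_l; lra).
  assert (0 <= (1 - q) * (1 - q * q ^ k)) by (apply Rmult_le_pos; nra).
  nra.
Qed.

Lemma qfall_bounds q n k : 0 < q < 1 -> 0 <= qfall q n k <= 1.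
Proof.
  intros Hq; induction k as [|k IH]; simpl; [lra|].
  pose proof (pow_lt q (n - k) (proj1 Hq)).
  assert (q ^ (n - k) <= 1) by (rewrite <- (pow1 (n - k)); apply pow_incr; lra).
  nra.
Qed.

Lemma qfall_lim q k : 0 < q < 1 -> is_lim_seq (fun n => qfall q n k) 1.
Proof.
  intros Hq; induction k as [|k IH]; simpl; [apply is_lim_seq_const|].
  replace (Finite 1) with (Finite (1 * (1 - 0))) by (f_equal; ring).
  apply is_lim_seq_mult'; [exact IH|]; apply is_lim_seq_minus'; [apply is_lim_seq_const|].
  (* After the shift by [k] the truncated subtraction in the exponent is exact. *)
  apply is_lim_seq_incr_n with k.
  apply (is_lim_seq_ext (fun n => q ^ n)); [intros n; f_equal; lia|].
  apply is_lim_seq_geom; rewrite Rabs_pos_eq; lra.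
Qed.

(** * The Jackson Bessel function *)

Section Jackson.
Variables q nu : R.
Hypotheses (hq0 : 0 < q) (hq1 : q < 1) (hnu : -1 < nu).

Let Q : R := Rpower q (nu + 1).

(** Unsigned coefficients of [F]. Differentiating [z^(2n+1)] produces the factor [2n + 1] in [beta],
    the coefficients of [G]. *)
Definition alpha (n : nat) : R :=
  Rpower q (INR n * (INR n + nu)) / (4 ^ n * qpoch q q n * qpoch (Rpower q (nu + 1)) q n).

Definition beta (n : nat) : R := INR (2 * n + 1) * alpha n.

Lemma Rpower_lt1 x : 0 < x -> 0 < Rpower q x < 1.
Proof.
  intros Hx; split; [apply exp_pos|]; rewrite <- exp_0; apply exp_increasing.
  assert (ln q < 0) by (rewrite <- ln_1; apply ln_increasing; lra). nra.
Qed.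

Let HQ : 0 < Q < 1.
Proof. apply Rpower_lt1; lra. Qed.

Let Hq : 0 < q < 1.
Proof. lra. Qed.

Lemma qpow_bounds k : 0 < q ^ k <= 1.
Proof.
  split; [apply pow_lt; lra|]; rewrite <- (pow1 k); apply pow_incr; lra.
Qed.

Lemma alpha_gt0 k : 0 < alpha k.
Proof.
  unfold alpha; apply Rdiv_lt_0_compat; [apply exp_pos|].
  repeat apply Rmult_lt_0_compat; [apply pow_lt; lra|apply qpoch_pos; lra|].
  apply qpoch_pos; auto.
Qed.

(** The hypothesis of [qlaguerre_real_rooted] with [c = Q / 4]; from [k] to [k + 1] the exponent
    [k (k + nu)] grows by [2 k + nu + 1]. *)
Lemma alpha_rec k :
  alpha (S k) * ((1 - q ^ S k) * (1 - Q * q ^ k)) = q ^ (2 * k) * (Q / 4) * alpha k.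
Proof.
  unfold alpha; fold Q; simpl qpoch.
  replace (INR (S k) * (INR (S k) + nu)) with (INR k * (INR k + nu) + (INR (2 * k) + (nu + 1)))
    by (rewrite S_INR, mult_INR; simpl; ring).
  rewrite 2!Rpower_plus, Rpower_pow by lra; fold Q.
  pose proof (qpoch_pos q q k Hq Hq); pose proof (qpoch_pos Q q k HQ Hq).
  pose proof (qpow_bounds k).
  assert (0 < 1 - q * q ^ k) by nra. assert (0 < 1 - Q * q ^ k) by nra.
  assert (0 < 4 ^ k) by (apply pow_lt; lra).
  change (4 ^ S k) with (4 * 4 ^ k). change (q ^ S k) with (q * q ^ k).
  field; repeat split; lra.
Qed.

Lemma alpha_0 : alpha 0 = 1.
Proof.
  unfold alpha; simpl; rewrite Rmult_0_l, Rpower_O by lra; field.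
Qed.

Let K : R := Q / 4 / ((1 - q) * (1 - Q)).

Let K_gt0 : 0 < K.
Proof.
  unfold K; apply Rdiv_lt_0_compat; [lra|apply Rmult_lt_0_compat; lra].
Qed.

Lemma alpha_ratio k : alpha (S k) <= K * q ^ (2 * k) * alpha k.
Proof.
  pose proof (alpha_rec k) as E; pose proof (alpha_gt0 (S k)) as P; pose proof (qpow_bounds k).
  assert (L : (1 - q) * (1 - Q) <= (1 - q ^ S k) * (1 - Q * q ^ k)).
  { simpl; apply Rmult_le_compat; nra. }
  assert (L' : 0 < (1 - q) * (1 - Q)) by (apply Rmult_lt_0_compat; lra).
  apply Rmult_le_reg_r with (1 := L').
  replace (K * q ^ (2 * k) * alpha k * ((1 - q) * (1 - Q))) with (q ^ (2 * k) * (Q / 4) * alpha k)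
    by (unfold K; field; lra).
  rewrite <- E; apply Rmult_le_compat_l; lra.
Qed.

Lemma entire_alpha : entire alpha.
Proof.
  intros x; apply (CV_disk_DAlembert alpha x 0); [|  | now left].
  - intros n; pose proof (alpha_gt0 n); lra.
  - apply (is_lim_seq_le_le (fun _ => 0) _ (fun n => K * q ^ n)).
    + intros n; split; [apply Rabs_pos|].
      pose proof (alpha_gt0 n) as P; pose proof (alpha_gt0 (S n)); pose proof (alpha_ratio n) as R.
      rewrite Rabs_pos_eq by (apply Rdiv_le_0_compat; lra).
      apply Rmult_le_reg_r with (1 := P); unfold Rdiv; rewrite Rmult_assoc, Rinv_l, Rmult_1_r by lra.
      eapply Rle_trans; [exact R|]; apply Rmult_le_compat_r; [lra|].
      apply Rmult_le_compat_l; [lra|].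
      replace (2 * n)%nat with (n + n)%nat by lia; rewrite pow_add.
      pose proof (qpow_bounds n); nra.
    + apply is_lim_seq_const.
    + replace (Finite 0) with (Finite (K * 0)) by (f_equal; ring).
      apply is_lim_seq_mult'; [apply is_lim_seq_const|].
      apply is_lim_seq_geom; rewrite Rabs_pos_eq; lra.
Qed.

Lemma beta_gt0 k : 0 < beta k.
Proof. apply Rmult_lt_0_compat; [apply lt_0_INR; lia|apply alpha_gt0]. Qed.

(** Of the factor [q^(2k)] in [alpha_ratio], one [q^k] pays for [k + 1] by [INR_pow_le] and the
    other tends to 0. The constant 3 comes from [2k + 3 <= 3 (2k + 1)]. *)
Lemma beta_decay eps : 0 < eps ->
  exists N, forall k, (N <= k)%nat -> INR (S k) * beta (S k) <= eps * beta k.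
Proof.
  intros He.
  assert (L : is_lim_seq (fun n => 3 * K / (1 - q) * q ^ n) 0).
  { replace (Finite 0) with (Finite (3 * K / (1 - q) * 0)) by (f_equal; ring).
    apply is_lim_seq_mult'; [apply is_lim_seq_const|].
    apply is_lim_seq_geom; rewrite Rabs_pos_eq; lra. }
  apply is_lim_seq_spec in L; destruct (L (mkposreal eps He)) as [N HN].
  exists N; intros k Hk; specialize (HN k Hk); simpl in HN; apply Rabs_def2 in HN.
  unfold beta.
  pose proof (alpha_gt0 k) as P; pose proof (alpha_gt0 (S k)) as P'; pose proof (qpow_bounds k) as B.
  pose proof (alpha_ratio k) as R; pose proof (INR_pow_le q k Hq) as I.
  replace (2 * k)%nat with (k + k)%nat in R by lia; rewrite pow_add in R.
  assert (E : INR (2 * S k + 1) <= INR 3 * INR (2 * k + 1)).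
  { rewrite <- (mult_INR 3); apply le_INR; lia. }
  assert (P2 : 0 < INR (2 * k + 1)) by (apply lt_0_INR; lia).
  assert (P3 : 0 < INR (S k)) by (apply lt_0_INR; lia).
  assert (E1 : INR (S k) * alpha (S k) <= K * q ^ k / (1 - q) * alpha k).
  { apply Rle_trans with (K * q ^ k * alpha k * (INR (S k) * q ^ k)).
    - apply Rle_trans with (INR (S k) * (K * (q ^ k * q ^ k) * alpha k)); [|right; ring].
      apply Rmult_le_compat_l; lra.
    - replace (K * q ^ k / (1 - q) * alpha k) with (K * q ^ k * alpha k * / (1 - q)) by (field; lra).
      apply Rmult_le_compat_l; [apply Rmult_le_pos; [apply Rmult_le_pos|]; lra|].
      apply Rmult_le_reg_r with (1 - q); [lra|]; rewrite Rinv_l; lra. }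
  assert (E2 : K * q ^ k / (1 - q) * 3 <= eps).
  { replace (K * q ^ k / (1 - q) * 3) with (3 * K / (1 - q) * q ^ k) by (field; lra); lra. }
  replace (INR (S k) * (INR (2 * S k + 1) * alpha (S k)))
    with (INR (2 * S k + 1) * (INR (S k) * alpha (S k))) by ring.
  simpl (INR 3) in E; apply Rle_trans with (3 * INR (2 * k + 1) * (K * q ^ k / (1 - q) * alpha k)).
  - apply Rmult_le_compat; try lra; [apply pos_INR|apply Rmult_le_pos; lra].
  - replace (3 * INR (2 * k + 1) * (K * q ^ k / (1 - q) * alpha k))
      with (K * q ^ k / (1 - q) * 3 * (INR (2 * k + 1) * alpha k)) by ring.
    apply Rmult_le_compat_r; [apply Rmult_le_pos; lra|exact E2].
Qed.

Lemma entire_beta : entire beta.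
Proof. apply entire_odd, entire_alpha. Qed.

Lemma real_rooted_approx : exists s t : nat -> list R,
  (forall N, Forall (Rlt 0) (s N)) /\ (forall N, Forall (Rlt 0) (t N)) /\
  dominated_limit (fun N => elsym (s N)) alpha /\
  dominated_limit (fun N => elsym (t N)) beta.
Proof.
  assert (HQ4 : 0 < Q / 4) by lra.
  pose proof (@RealRooted.qlaguerre_real_rooted q Q (Q / 4) alpha Hq HQ HQ4 alpha_0 alpha_rec) as H.
  assert (H' : forall n, exists st : list R * list R,
    Forall (Rlt 0) (fst st) /\ Forall (Rlt 0) (snd st) /\
    (forall k, elsym (fst st) k = qfall q n k * alpha k) /\
    (forall k, elsym (snd st) k = INR (2 * k + 1) * elsym (fst st) k)).
  { intros n; destruct (H n) as [s [t Hst]]; exists (s, t); exact Hst. }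
  (* Chooses one pair of lists for each [n], so that both sequences stem from the same
     truncations. *)
  set (st := fun n => proj1_sig (constructive_indefinite_description _ (H' n))).
  assert (Hst : forall n, Forall (Rlt 0) (fst (st n)) /\ Forall (Rlt 0) (snd (st n)) /\
    (forall k, elsym (fst (st n)) k = qfall q n k * alpha k) /\
    (forall k, elsym (snd (st n)) k = INR (2 * k + 1) * elsym (fst (st n)) k))
    by (intros n; exact (proj2_sig (constructive_indefinite_description _ (H' n)))).
  assert (L : dominated_limit (fun N => elsym (fst (st N))) alpha).
  { split; [exact entire_alpha|split; [intros k; left; apply alpha_gt0|]].
    exists (qfall q); repeat split.
    - now apply qfall_bounds.
    - now apply qfall_bounds.
    - intros k; now apply qfall_lim.
    - apply Hst. }
  exists (fun n => fst (st n)), (fun n => snd (st n)); repeat split; try apply Hst; try apply L.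
  - exact entire_beta.
  - intros k; left; apply beta_gt0.
  - exists (qfall q); repeat split.
    + now apply qfall_bounds.
    + now apply qfall_bounds.
    + intros k; now apply qfall_lim.
    + intros N k; destruct (Hst N) as [_ [_ [H1 H2]]]; rewrite H2, H1; unfold beta; ring.
Qed.

Lemma g2_eq z : g2 nu q z = (z * Ceval alpha (- (z * z)))%C.
Proof.
  rewrite <- odd_series_eq by exact entire_alpha.
  unfold g2, CSum; f_equal; apply Series_ext; intros n; unfold g2_coef, alpha;
    generalize (z ^ (2 * n + 1))%C; intros [x y]; simpl; unfold Rdiv; ring.
Qed.

Lemma g2_derive z :
  is_derive (K := C_AbsRing) (V := C_NormedModule) (g2 nu q) z (Ceval beta (- (z * z))).
Proof.
  apply is_derive_ext with (2 := odd_series_derive alpha entire_alpha z).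
  intros y; rewrite g2_eq; apply odd_series_eq, entire_alpha.
Qed.

Lemma PSeries_beta x : PSeries beta x = PSeries alpha x + 2 * PSeries (fun k => INR k * alpha k) x.
Proof.
  apply RtoC_inj; rewrite RtoC_plus, RtoC_mult, <- !Ceval_RtoC.
  apply Ceval_odd, entire_alpha.
Qed.

Lemma PSeries_INR_derive x :
  PSeries (fun k => INR k * alpha k) x = x * Derive (PSeries alpha) x.
Proof.
  rewrite Derive_PSeries by apply entire_CV_radius, entire_alpha.
  rewrite <- PSeries_incr_1; apply PSeries_ext; intros [|n]; unfold PS_incr_1, PS_derive; simpl;
    [rewrite Rmult_0_l|]; reflexivity.
Qed.

Lemma ex_derive_alpha x : ex_derive (PSeries alpha) x.
Proof. apply ex_derive_PSeries, entire_CV_radius, entire_alpha. Qed.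

Lemma J2_eq r : 0 < r ->
  J2 nu q r = qpoch_inf Q q / qpoch_inf q q * (Rpower (r / 2) nu * PSeries alpha (- r ^ 2)).
Proof.
  intros Hr; unfold J2; fold Q; f_equal.
  unfold PSeries; rewrite <- Series_scal_l; apply Series_ext; intros n.
  unfold alpha; fold Q.
  replace (2 * INR n + nu) with (INR (2 * n) + nu) by (rewrite mult_INR; simpl; ring).
  rewrite Rpower_plus, Rpower_pow by lra.
  replace ((r / 2) ^ (2 * n)) with ((r ^ 2) ^ n / 4 ^ n).
  2: { rewrite pow_mult; unfold Rdiv; rewrite <- pow_inv, <- Rpow_mult_distr; f_equal; field. }
  replace ((- r ^ 2) ^ n) with ((-1) ^ n * (r ^ 2) ^ n)
    by (rewrite <- Rpow_mult_distr; f_equal; ring).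
  pose proof (qpoch_pos q q n Hq Hq); pose proof (qpoch_pos Q q n HQ Hq).
  assert (4 ^ n <> 0) by (apply pow_nonzero; lra).
  field; repeat split; lra.
Qed.

(** [J2] is a constant times [r^(nu-1) g(r)], so the left-hand side is that constant times
    [r^nu g'(r)], and [g'(r) = G(r^2)]. *)
Lemma J2_equation r : 0 < r ->
  r * Derive (J2 nu q) r - (nu - 1) * J2 nu q r
  = qpoch_inf Q q / qpoch_inf q q * Rpower (r / 2) nu * PSeries beta (- r ^ 2).
Proof.
  intros Hr; rewrite (J2_eq r Hr).
  set (c := qpoch_inf Q q / qpoch_inf q q).
  assert (D : is_derive (J2 nu q) r
    (c * (nu / r * Rpower (r / 2) nu * PSeries alpha (- r ^ 2)
          + Rpower (r / 2) nu * (- (2 * r) * Derive (PSeries alpha) (- r ^ 2))))).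
  (* [J2_eq] holds for positive arguments only; the ball of radius [r] around [r] stays among
     them. *)
  { apply (is_derive_ext_loc (fun r => c * (Rpower (r / 2) nu * PSeries alpha (- r ^ 2)))).
    - exists (mkposreal r Hr); intros y Hy; symmetry; apply J2_eq.
      change (Rabs (y - r) < r) in Hy; apply Rabs_def2 in Hy; lra.
    - unfold Rpower; auto_derive.
      + repeat split; try lra; apply ex_derive_alpha.
      + change (fun x => PSeries alpha x) with (PSeries alpha).
        replace (- (r * (r * 1))) with (- r ^ 2) by ring.
        unfold Rdiv; field; lra. }
  rewrite (is_derive_unique _ _ _ D), PSeries_beta, PSeries_INR_derive.
  field; lra.
Qed.

(** By the mean value theorem [u F(u^2)], which is 0 at 0, is positive as long as its derivative
    [G(v^2)] is positive for [0 < v < u]. *)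
Lemma alpha_pos_below w : (forall x, 0 <= x < w -> 0 < PSeries beta (- x)) ->
  forall x, 0 <= x < w -> 0 < PSeries alpha (- x).
Proof.
  intros Hb x Hx.
  destruct (Req_dec x 0) as [->|Hx0].
  { rewrite Ropp_0, PSeries_0, alpha_0; lra. }
  set (u := sqrt x); assert (Hu : 0 < u) by (apply sqrt_lt_R0; lra).
  assert (Eu : u ^ 2 = x) by (unfold u; apply pow2_sqrt; lra).
  destruct (MVT_cor2 (fun v => v * PSeries alpha (- v ^ 2)) (fun v => PSeries beta (- v ^ 2)) 0 u Hu)
    as [v [E Hv]].
  - intros v _; apply is_derive_Reals.
    rewrite PSeries_beta, PSeries_INR_derive; auto_derive; [apply ex_derive_alpha|].
    change (fun x => PSeries alpha x) with (PSeries alpha).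
    replace (- (v * (v * 1))) with (- v ^ 2) by ring; ring.
  - rewrite Eu in E.
    assert (0 < PSeries beta (- v ^ 2)) by (apply Hb; nra).
    assert (0 < PSeries beta (- v ^ 2) * (u - 0)) by (apply Rmult_lt_0_compat; lra).
    apply Rmult_lt_reg_l with u; lra.
Qed.

End Jackson.

(** * Radius of starlikeness *)

Section Starlike.
Variables q nu : R.
Hypotheses (hq0 : 0 < q) (hq1 : q < 1) (hnu : -1 < nu).
Variables (s : nat -> list R) (w : R).
Hypothesis s_pos : forall N, Forall (Rlt 0) (s N).
Hypothesis s_lim : dominated_limit (fun N => elsym (s N)) (alpha q nu).
Hypothesis w_pos : 0 < w.
Hypothesis w_zero : PSeries (beta q nu) (- w) = 0.
Hypothesis below_w : forall x, 0 <= x < w -> 0 < PSeries (beta q nu) (- x).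

Let rs := sqrt w.

Let rs_pos : 0 < rs.
Proof. apply sqrt_lt_R0, w_pos. Qed.

Let rs_sq : rs ^ 2 = w.
Proof. apply pow2_sqrt; lra. Qed.

(* With [A = F(z^2)] and [B = z^2 F'(z^2)] the quotient is [1 + 2 B / A], and
   [|B / A|] is largest on the positive axis. *)
Lemma starlike_inside z : 0 < Cmod z < rs ->
  exists l : C, is_derive (K := C_AbsRing) (V := C_NormedModule) (g2 nu q) z l /\
    g2 nu q z <> 0%C /\ 0 < Re (z * l / g2 nu q z)%C.
Proof.
  intros [Hz0 Hz]; exists (Ceval (beta q nu) (- (z * z))).
  split; [apply g2_derive; assumption|].
  set (r := Cmod z ^ 2).
  assert (Hr : 0 <= r < w) by (unfold r; rewrite <- rs_sq; split; nra).
  assert (Ha : forall x, 0 <= x < w -> 0 < PSeries (alpha q nu) (- x))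
    by (apply alpha_pos_below; assumption).
  assert (Hm : Cmod (- (z * z))%C <= r).
  { rewrite Cmod_opp, Cmod_mult; unfold r; right; ring. }
  destruct (min_modulus _ s s_lim s_pos r (- (z * z))%C) as [M1 M2]; [|exact Hm|].
  { intros x Hx; apply Ha; lra. }
  pose proof (Ha r Hr) as Fr; pose proof (below_w r Hr) as Gr.
  rewrite PSeries_beta in Gr by assumption.
  rewrite g2_eq by assumption.
  unfold beta; rewrite Ceval_odd by (apply entire_alpha; assumption).
  set (A := Ceval (alpha q nu) (- (z * z))) in *.
  set (B := Ceval (fun k => INR k * alpha q nu k) (- (z * z))) in *.
  set (F0 := PSeries (alpha q nu) (- r)) in *.
  set (F1 := PSeries (fun k => INR k * alpha q nu k) (- r)) in *.
  assert (HA : A <> 0%C) by (apply Cmod_gt_0; lra).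
  assert (Hz' : z <> 0%C) by (now apply Cmod_gt_0).
  split; [now apply Cmult_neq_0|].
  replace (z * (A + 2 * B) / (z * A))%C with (1 + 2 * (B / A))%C by (field; auto).
  (* [M2] bounds [|B / A|] by [- F1 / F0], and [F0 + 2 F1 > 0] is the positivity of [G] at [r]. *)
  assert (HB : Cmod (B / A)%C < 1 / 2).
  { rewrite Cmod_div by exact HA; set (a := Cmod A) in *; set (b := Cmod B) in *.
    assert (Hapos : 0 < a) by lra.
    apply Rmult_lt_reg_r with (a * F0); [apply Rmult_lt_0_compat; lra|].
    replace (b / a * (a * F0)) with (b * F0) by (field; lra).
    apply Rle_lt_trans with (1 := M2). nra. }
  pose proof (re_le_Cmod (B / A)%C) as HRe.
  assert (E : Re (1 + 2 * (B / A))%C = 1 + 2 * Re (B / A)%C).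
  { destruct (B / A)%C as [x y]; simpl; ring. }
  rewrite E; apply Rabs_le_between in HRe; lra.
Qed.

(** At the real point [z = rs] the derivative is the value of [G] at its zero [w], so the quotient
    is 0 there and no larger disc qualifies. *)
Lemma starlike_radius : is_radius_starlike (g2 nu q) rs.
Proof.
  split.
  - intros r [Hr Hstar]; apply Rnot_lt_le; intros Hlt.
    destruct (Hstar (RtoC rs)) as [l [Hd [_ Hre]]].
    { rewrite Cmod_RtoC_pos by lra; lra. }
    assert (El : l = 0%C).
    { rewrite <- (is_C_derive_unique _ _ _ Hd).
      rewrite (is_C_derive_unique _ _ _ (g2_derive q nu hq0 hq1 hnu (RtoC rs))).
      replace (- (RtoC rs * RtoC rs))%C with (RtoC (- w)).
      - now rewrite Ceval_RtoC, w_zero.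
      - rewrite <- rs_sq, <- RtoC_mult, <- RtoC_opp; f_equal; ring. }
    rewrite El in Hre; unfold Cdiv in Hre.
    replace (RtoC rs * 0 * / g2 nu q (RtoC rs))%C with (RtoC 0) in Hre by ring.
    simpl in Hre; lra.
  - intros b Hb; apply Hb; split; [exact rs_pos|exact starlike_inside].
Qed.

Lemma first_root_equation :
  rs * Derive (J2 nu q) rs - (nu - 1) * J2 nu q rs = 0 /\
  (forall r, 0 < r < rs -> r * Derive (J2 nu q) r - (nu - 1) * J2 nu q r <> 0).
Proof.
  split.
  - rewrite J2_equation by assumption; rewrite rs_sq, w_zero; ring.
  - intros r Hr; rewrite (J2_equation q nu hq0 hq1 hnu r (proj1 Hr)).
    assert (0 < PSeries (beta q nu) (- r ^ 2)).
    { apply below_w; rewrite <- rs_sq; split; nra. }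
    assert (0 < Rpower (r / 2) nu) by apply exp_pos.
    assert (0 < qpoch_inf (Rpower q (nu + 1)) q / qpoch_inf q q).
    { apply Rdiv_lt_0_compat; apply qpoch_inf_pos; try lra; apply Rpower_lt1; lra. }
    apply Rgt_not_eq, Rmult_lt_0_compat; [apply Rmult_lt_0_compat|]; assumption.
Qed.

End Starlike.

(** * Closed forms of the power sums and the four bounds *)

Lemma two_sqrt x : 2 * sqrt x = sqrt (4 * x).
Proof.
  rewrite sqrt_mult_alt by lra; replace 4 with (2 * 2) by ring; now rewrite sqrt_square by lra.
Qed.

Section PowerSums.
Variables q nu : R.
Hypotheses (hq0 : 0 < q) (hq1 : q < 1) (hnu : -1 < nu).

Let Q := Rpower q (nu + 1).

Let HQ : 0 < Q < 1.
Proof. apply Rpower_lt1; lra. Qed.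

Let b := beta q nu.

Lemma Rpower_shift m : Rpower q (nu + INR (S m)) = Q * q ^ m.
Proof.
  rewrite S_INR; replace (nu + (INR m + 1)) with (nu + 1 + INR m) by ring.
  now rewrite Rpower_plus, Rpower_pow.
Qed.

Lemma Rpower_shift2 m : Rpower q (2 * nu + INR (S (S m))) = Q ^ 2 * q ^ m.
Proof.
  rewrite !S_INR; replace (2 * nu + (INR m + 1 + 1)) with (nu + 1 + (nu + 1) + INR m) by ring.
  rewrite 2!Rpower_plus, Rpower_pow by assumption; fold Q; ring.
Qed.

Lemma D_nu_eq : D_nu nu q = 9 * q - 9 * (Q * q) + Q * q ^ 2 - 10 * q ^ 2 + 9.
Proof.
  unfold D_nu; pose proof (Rpower_shift 1) as H1; pose proof (Rpower_shift 2) as H2.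
  simpl INR in H1, H2; replace (1 + 1 + 1) with 3 in H2 by ring; replace (1 + 1) with 2 in H1 by ring.
  rewrite H1, H2; ring.
Qed.

Lemma ab_nu_eq : a_nu nu q + b_nu nu q =
  - 9 * (Q * q) - 12 * (Q * q ^ 2) - 21 * (Q * q ^ 3) + 3 * (Q * q ^ 4) + 6 * (Q * q ^ 5)
  + Q * q ^ 6 + 9 * (Q ^ 2 * q ^ 3) + 3 * (Q ^ 2 * q ^ 4) + 3 * (Q ^ 2 * q ^ 5) + Q ^ 2 * q ^ 6
  + 18 * q + 3 * q ^ 2 - 6 * q ^ 3 - 15 * q ^ 4 + 7 * q ^ 6 + 9.
Proof.
  unfold a_nu, b_nu.
  assert (H : forall m x, x = INR (S m) -> Rpower q (nu + x) = Q * q ^ m)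
    by (intros m x ->; apply Rpower_shift).
  assert (H' : forall m x, x = INR (S (S m)) -> Rpower q (2 * nu + x) = Q ^ 2 * q ^ m)
    by (intros m x ->; apply Rpower_shift2).
  rewrite (H 1%nat 2), (H 2%nat 3), (H 3%nat 4), (H 4%nat 5), (H 5%nat 6), (H 6%nat 7),
    (H' 3%nat 5), (H' 4%nat 6), (H' 5%nat 7), (H' 6%nat 8) by (simpl; ring).
  simpl INR; ring.
Qed.

Let den_pos : 0 < 1 - q /\ 0 < 1 - Q /\ 0 < 1 - Q * q /\ 0 < 1 - Q * q ^ 2.
Proof. repeat split; nra. Qed.

Lemma beta_1 : b 1%nat = 3 * (Q / (4 * (1 - q) * (1 - Q))).
Proof.
  destruct den_pos as [P1 [P2 [P3 P4]]].
  pose proof (alpha_rec q nu hq0 hq1 hnu 0) as E; fold Q in E; rewrite (alpha_0 q nu hq0) in E.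
  unfold b, beta; simpl INR.
  apply Rmult_eq_reg_r with ((1 - q ^ 1) * (1 - Q * q ^ 0)); [|simpl; nra].
  rewrite Rmult_assoc, E; simpl; field; lra.
Qed.

Lemma beta_2 : b 2%nat =
  5 * (Q ^ 2 * q ^ 2 / (16 * ((1 - q) ^ 2 * (1 + q) * (1 - Q) * (1 - Q * q)))).
Proof.
  destruct den_pos as [P1 [P2 [P3 P4]]].
  pose proof (alpha_rec q nu hq0 hq1 hnu 1) as E; fold Q in E.
  pose proof beta_1 as E1; unfold b, beta in E1 |- *; simpl INR in E1 |- *.
  replace (alpha q nu 1) with (Q / (4 * (1 - q) * (1 - Q))) in E by lra.
  apply Rmult_eq_reg_r with ((1 - q ^ 2) * (1 - Q * q ^ 1)).
  - rewrite Rmult_assoc, E; simpl; field; repeat split; lra.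
  - replace (1 - q ^ 2) with ((1 - q) * (1 + q)) by ring; rewrite pow_1.
    apply Rgt_not_eq, Rmult_lt_0_compat; [apply Rmult_lt_0_compat|]; lra.
Qed.

Lemma beta_3 : b 3%nat =
  7 * (Q ^ 3 * q ^ 6 / (64 * ((1 - q) ^ 3 * (1 + q) * (1 + q + q ^ 2)
    * (1 - Q) * (1 - Q * q) * (1 - Q * q ^ 2)))).
Proof.
  destruct den_pos as [P1 [P2 [P3 P4]]].
  pose proof (alpha_rec q nu hq0 hq1 hnu 2) as E; fold Q in E.
  pose proof beta_2 as E1; unfold b, beta in E1 |- *; simpl INR in E1 |- *.
  replace (alpha q nu 2) with
    (Q ^ 2 * q ^ 2 / (16 * ((1 - q) ^ 2 * (1 + q) * (1 - Q) * (1 - Q * q)))) in E by lra.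
  assert (0 < 1 + q + q ^ 2) by nra.
  apply Rmult_eq_reg_r with ((1 - q ^ 3) * (1 - Q * q ^ 2)).
  - rewrite Rmult_assoc, E; simpl; field; repeat split; try lra; simpl in *; lra.
  - replace (1 - q ^ 3) with ((1 - q) * (1 + q + q ^ 2)) by ring.
    apply Rgt_not_eq, Rmult_lt_0_compat; [apply Rmult_lt_0_compat|]; assumption.
Qed.

(** Origin of [D_nu]: over the common denominator the numerator is
    [9 (1 + q)(1 - Q q) - 10 q^2 (1 - Q)]. *)
Lemma S2_eq : b 1%nat ^ 2 - 2 * b 2%nat =
  Q ^ 2 * D_nu nu q / (16 * ((1 - q) ^ 2 * (1 - Q) ^ 2 * (1 + q) * (1 - Q * q))).
Proof.
  destruct den_pos as [P1 [P2 [P3 P4]]].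
  rewrite beta_1, beta_2, D_nu_eq; field; lra.
Qed.

(** Origin of [a_nu + b_nu], the numerator of the third power sum up to [3 Q^3]. *)
Lemma S3_eq : b 1%nat ^ 3 - 3 * b 1%nat * b 2%nat + 3 * b 3%nat =
  3 * Q ^ 3 * (a_nu nu q + b_nu nu q) / (64 * ((1 - q) ^ 3 * (1 - Q) ^ 3 * (1 + q)
     * (1 + q + q ^ 2) * (1 - Q * q) * (1 - Q * q ^ 2))).
Proof.
  destruct den_pos as [P1 [P2 [P3 P4]]].
  assert (0 < 1 + q + q ^ 2) by nra.
  rewrite beta_1, beta_2, beta_3, ab_nu_eq; field; repeat split; lra.
Qed.

(** With [w] the square of the radius, the four bounds are in turn [1/S1 < w], [w < S1/S2],
    [1/S2 < w^2] and [w < S2/S3]. *)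
Lemma radius_bounds w :
  let S1 := b 1%nat in
  let S2 := b 1%nat ^ 2 - 2 * b 2%nat in
  let S3 := b 1%nat ^ 3 - 3 * b 1%nat * b 2%nat + 3 * b 3%nat in
  0 < w -> 0 < S2 -> 0 < S3 ->
  w * S2 < S1 -> w * S3 < S2 -> 1 < S1 * w -> 1 < S2 * w ^ 2 ->
  2 * sqrt ((Rpower q (nu + 1) - 1) * (q - 1) / (3 * Rpower q (nu + 1))) < sqrt w /\
  sqrt w < 2 * sqrt (3 * (Rpower q (nu + 1) - 1) * (Rpower q (nu + 2) - 1) * (1 - q ^ 2)
                   / (Rpower q (nu + 1) * D_nu nu q)) /\
  2 * Rpower ((Rpower q (nu + 1) - 1) ^ 2 * (1 - Rpower q (nu + 2)) * (q - 1) ^ 2 * (q + 1)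
                / (Rpower q (2 * nu + 2) * D_nu nu q)) (1 / 4) < sqrt w /\
  sqrt w < 2 / 3 * sqrt (3 * (1 - Rpower q (nu + 1)) * (Rpower q (nu + 3) - 1) * (q - 1)
                       / ((q + 1) * Rpower q (nu + 1)) * q1_star nu q).
Proof.
  intros S1 S2 S3 Hw HS2 HS3 H1 H2 H3 H4.
  destruct den_pos as [P1 [P2 [P3 P4]]].
  assert (P5 : 0 < 1 + q + q ^ 2) by nra.
  assert (HS1 : 0 < S1) by (apply beta_gt0; assumption).
  pose proof S2_eq as E2; pose proof S3_eq as E3; fold S2 in E2; fold S3 in E3.
  (* The signs of [D_nu] and of [a_nu + b_nu] are read off from [S2 > 0] and [S3 > 0], without
     analysing these polynomials. *)
  assert (HD : 0 < D_nu nu q).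
  { apply Rnot_le_lt; intros Hn; apply (Rlt_not_le _ _ HS2); rewrite E2.
    assert (Hd : 0 < 16 * ((1 - q) ^ 2 * (1 - Q) ^ 2 * (1 + q) * (1 - Q * q)))
      by (repeat apply Rmult_lt_0_compat; try apply pow_lt; lra).
    apply Rmult_le_reg_r with (1 := Hd); unfold Rdiv; rewrite Rmult_assoc, Rinv_l by lra.
    assert (0 < Q ^ 2) by (apply pow_lt; lra). nra. }
  assert (Hab : 0 < a_nu nu q + b_nu nu q).
  { apply Rnot_le_lt; intros Hn; apply (Rlt_not_le _ _ HS3); rewrite E3.
    assert (Hd : 0 < 64 * ((1 - q) ^ 3 * (1 - Q) ^ 3 * (1 + q)
     * (1 + q + q ^ 2) * (1 - Q * q) * (1 - Q * q ^ 2)))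
      by (repeat apply Rmult_lt_0_compat; try apply pow_lt; lra).
    apply Rmult_le_reg_r with (1 := Hd); unfold Rdiv; rewrite Rmult_assoc, Rinv_l by lra.
    assert (0 < Q ^ 3) by (apply pow_lt; lra). nra. }
  assert (R2 : Rpower q (nu + 2) = Q * q).
  { rewrite <- (pow_1 q) at 2; rewrite <- Rpower_shift; f_equal; simpl; ring. }
  assert (R3 : Rpower q (nu + 3) = Q * q ^ 2) by (rewrite <- Rpower_shift; f_equal; simpl; ring).
  assert (R22 : Rpower q (2 * nu + 2) = Q ^ 2).
  { rewrite <- (Rmult_1_r (Q ^ 2)), <- (pow_O q), <- Rpower_shift2; f_equal; simpl; ring. }
  rewrite R2, R3, R22; fold Q; unfold q1_star.
  pose proof beta_1 as E1; fold S1 in E1.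
  repeat split.
  - rewrite two_sqrt; apply sqrt_lt_1_alt; split.
    + apply Rmult_le_pos; [lra|]; apply Rdiv_le_0_compat; nra.
    + apply Rmult_lt_reg_l with S1; [exact HS1|].
      apply Rle_lt_trans with 1; [|exact H3]; right; rewrite E1; field; lra.
  - rewrite two_sqrt; apply sqrt_lt_1_alt; split; [lra|].
    apply Rmult_lt_reg_r with S2; [exact HS2|].
    apply Rlt_le_trans with (1 := H1); right; rewrite E1, E2; field; lra.
  - set (Y := (Q - 1) ^ 2 * (1 - Q * q) * (q - 1) ^ 2 * (q + 1) / (Q ^ 2 * D_nu nu q)).
    assert (HY : 0 < Y).
    { unfold Y; replace (Q - 1) with (- (1 - Q)) by ring; replace (q - 1) with (- (1 - q)) by ring.
      rewrite <- !Rsqr_pow2, <- !Rsqr_neg, !Rsqr_pow2.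
      apply Rdiv_lt_0_compat; repeat apply Rmult_lt_0_compat; try apply pow_lt; lra. }
    assert (EY : S2 * (16 * Y) = 1) by (rewrite E2; unfold Y; field; lra).
    assert (ER : Rpower Y (1 / 4) = sqrt (sqrt Y)).
    { rewrite <- (Rpower_sqrt (sqrt Y)), <- (Rpower_sqrt Y), Rpower_mult by (try apply sqrt_lt_R0; exact HY).
      f_equal; field. }
    rewrite ER, two_sqrt; apply sqrt_lt_1_alt; split; [pose proof (sqrt_pos Y); lra|].
    apply Rsqr_incrst_0; [|pose proof (sqrt_pos Y); lra|lra].
    unfold Rsqr; replace (4 * sqrt Y * (4 * sqrt Y)) with (16 * (sqrt Y * sqrt Y)) by ring.
    rewrite sqrt_sqrt by lra.
    apply Rmult_lt_reg_l with S2; [exact HS2|]; rewrite EY; lra.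
  - set (X := 3 * (1 - Q) * (Q * q ^ 2 - 1) * (q - 1) / ((q + 1) * Q) *
      ((q ^ 3 + 2 * q ^ 2 + 2 * q + 1) * D_nu nu q / (a_nu nu q + b_nu nu q))).
    (* The cubic [q^3 + 2 q^2 + 2 q + 1] is [(1 + q)(1 + q + q^2)]: its first factor cancels the
       [q + 1] in [X], the second stems from the denominator of [S3]. *)
    assert (EX : S3 * (4 / 9 * X) = S2).
    { rewrite E2, E3; unfold X; field; repeat split; lra. }
    assert (T : 2 / 3 * sqrt X = sqrt (4 / 9 * X)).
    { rewrite sqrt_mult_alt by lra; replace (4 / 9) with ((2 / 3) * (2 / 3)) by field.
      now rewrite sqrt_square by lra. }
    rewrite T; apply sqrt_lt_1_alt; split; [lra|].
    apply Rmult_lt_reg_l with S3; [exact HS3|]; rewrite EX; lra.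
Qed.

End PowerSums.

Theorem theorem2 (q nu : R) (hq0 : 0 < q) (hq1 : q < 1) (hnu : -1 < nu) :
  exists rs : R,
    is_radius_starlike (g2 nu q) rs /\
    0 < rs /\
    rs * Derive (J2 nu q) rs - (nu - 1) * J2 nu q rs = 0 /\
    (forall r, 0 < r < rs -> r * Derive (J2 nu q) r - (nu - 1) * J2 nu q r <> 0) /\
    2 * sqrt ((Rpower q (nu + 1) - 1) * (q - 1) / (3 * Rpower q (nu + 1))) < rs /\
    rs < 2 * sqrt (3 * (Rpower q (nu + 1) - 1) * (Rpower q (nu + 2) - 1) * (1 - q ^ 2)
                   / (Rpower q (nu + 1) * D_nu nu q)) /\
    2 * Rpower ((Rpower q (nu + 1) - 1) ^ 2 * (1 - Rpower q (nu + 2)) * (q - 1) ^ 2 * (q + 1)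
                / (Rpower q (2 * nu + 2) * D_nu nu q)) (1 / 4) < rs /\
    rs < 2 / 3 * sqrt (3 * (1 - Rpower q (nu + 1)) * (Rpower q (nu + 3) - 1) * (q - 1)
                       / ((q + 1) * Rpower q (nu + 1)) * q1_star nu q).
Proof.
  (* The family [s] approximates [F] and serves the modulus estimates on discs; [t] approximates [G]
     and serves its first zero and power sums. *)
  destruct (real_rooted_approx q nu hq0 hq1 hnu) as [s [t [Hs [Ht [Ls Lt]]]]].
  assert (B0 : beta q nu 0 = 1) by (unfold beta; rewrite alpha_0 by assumption; simpl; ring).
  pose proof (beta_gt0 q nu hq0 hq1 hnu) as Bpos.
  pose proof (beta_decay q nu hq0 hq1 hnu) as Bdec.
  destruct (first_zero _ t Lt Ht B0 Bpos Bdec) as [w [Hw [Hz Hb]]].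
  destruct (euler_rayleigh _ t Lt Ht Bpos Bdec w Hw Hz Hb) as [I1 [I2 [I3 I4]]].
  pose proof (S2_gt0 _ t Lt Ht Bpos Bdec) as HS2.
  pose proof (S3_gt0 _ t Lt Ht Bpos Bdec) as HS3.
  exists (sqrt w).
  destruct (first_root_equation q nu hq0 hq1 hnu w Hw Hz Hb) as [R1 R2].
  split; [exact (starlike_radius q nu hq0 hq1 hnu s w Hs Ls Hw Hz Hb)|].
  split; [apply sqrt_lt_R0, Hw|].
  split; [exact R1|split; [exact R2|]].
  exact (radius_bounds q nu hq0 hq1 hnu w Hw HS2 HS3 I1 I2 I3 I4).
Qed.
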